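(* Let $W$ be a random variable with values in $(0,1)$ and let $L_n$ be the number of empty boxes within the occupancy range in the Bernoulli sieve with $n$ balls generated by $W$. If $L_n$ converges in distribution, as $n\to\infty$, to a random variable $L$ with proper and nondegenerate probability law, then $L$ has a mixed Poisson law.
   Context: Bernoulli sieve: let $(W_k)_{k\in\mathbb{N}}$ be independent copies of $W$ and set $P_k:=W_1W_2\cdots W_{k-1}(1-W_k)$, $k\in\mathbb{N}$. Conditionally given $(P_k)$, $n$ balls are allocated independently over an infinite array of boxes $1,2,\ldots$, each ball hitting box $j$ with probability $P_j$. Let $K_n$ be the number of occupied boxes, $M_n$ the index of the last (largest-index) occupied box, and $L_n:=M_n-K_n$ the number of empty boxes within the occupancy range. A law on $\mathbb{N}_0=\{0,1,2,\ldots\}$ is mixed Poisson if it is the law of $\pi(\Lambda)$, where $(\pi(t))_{t\ge0}$ is a unit rate Poisson process and $\Lambda$ is an a.s. finite nonnegative random variable independent of $\pi$. A law is proper if it is a probability law of an a.s. finite random variable. *)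

(* Defs.v *)
From HB Require Import structures.
From mathcomp Require Import all_boot all_order all_algebra.
From mathcomp Require Import all_classical all_reals all_analysis.

Set Implicit Arguments.
Unset Strict Implicit.
Unset Printing Implicit Defensive.

Import Order.TTheory GRing.Theory Num.Theory.
Import numFieldNormedType.Exports.

Local Open Scope classical_set_scope.
Local Open Scope ring_scope.

(* Mutual independence: the product rule over every finite subfamily. *)
Definition independent_RVs d (T : measurableType d) (R : realType)
    (P : probability T R) d' (T' : measurableType d') (I : eqType)
    (X : I -> {RV P >-> T'}) : Prop :=
  forall (s : seq I) (A : I -> set T'),
    uniq s -> (forall i, measurable (A i)) ->
    P (\bigcap_(i in [set` s]) (X i @^-1` A i)) =
      (\prod_(i <- s) P (X i @^-1` A i))%E.

(* sigma(X i : i in D), as a family of subsets of T. *)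
Definition sigma_generated (T : Type) d' (T' : measurableType d') (I : Type)
    (D : set I) (X : I -> T -> T') : set (set T) :=
  <<s \bigcup_(i in D) preimage_set_system [set: T] (X i) measurable >>.

Definition cvg_in_distribution (R : realType)
    d (T : measurableType d) (P : probability T R) (X : nat -> T -> R)
    d' (T' : measurableType d') (P' : probability T' R) (Y : {RV P' >-> R}) : Prop :=
  forall f : R -> R, continuous f -> (exists M : R, forall x, `|f x| <= M) ->
    ('E_P[f \o X n] @[n --> \oo] --> 'E_P'[f \o Y])%E.

Definition nondegenerate_law d (T : measurableType d) (R : realType)
    (P : probability T R) (X : {RV P >-> R}) : Prop :=
  ~ exists c : R, distribution P X [set c] = 1%E.

(* Counting process of the partial sums of i.i.d. standard exponential
   interarrival times: N t = max {k | E_1 + ... + E_k <= t}. *)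
Definition unit_rate_Poisson_process d (T : measurableType d) (R : realType)
    (P : probability T R) (N : R -> T -> nat) : Prop :=
  exists E : nat -> {RV P >-> R},
    [/\ independent_RVs E,
        forall k (A : set R), measurable A ->
          distribution P (E k) A = exponential_prob 1 A
      & forall (t : R) (w : T) (k : nat), 0 <= t ->
          (k <= N t w)%N = (\sum_(i < k) E i w <= t)].

Definition independent_of_process d (T : measurableType d) (R : realType)
    (P : probability T R) (Lam : {RV P >-> R}) (N : R -> T -> nat) : Prop :=
  forall (A : set R) (B : set T), measurable A ->
    sigma_generated [set t : R | 0 <= t] N B ->
    P (Lam @^-1` A `&` B) = (P (Lam @^-1` A) * P B)%E.

(* mu is a law on the real line; being mixed Poisson forces it to be carried
   by the image of nat. *)
Definition mixed_Poisson (R : realType) (mu : set R -> \bar R) : Prop :=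
  exists (d : measure_display) (T : measurableType d) (P : probability T R)
         (N : R -> T -> nat) (Lam : {RV P >-> R}),
    [/\ unit_rate_Poisson_process P N,
        forall w, 0 <= Lam w,
        independent_of_process Lam N
      & forall A : set R, measurable A ->
          mu A = P [set w | A (N (Lam w) w)%:R]].

Section BernoulliSieve.
Context d (T : measurableType d) (R : realType) (P : probability T R).

(* Indices are shifted by one: W k stands for W_{k+1} and a ball with value j
   lies in box j+1, whose conditional hitting probability is box_prob W j. *)
Definition box_prob (W : nat -> {RV P >-> R}) (k : nat) (w : T) : R :=
  (\prod_(i < k) W i w) * (1 - W k w).

Definition independent_copies d0 (T0 : measurableType d0)
    (P0 : probability T0 R) (W0 : {RV P0 >-> R}) (W : nat -> {RV P >-> R}) :=
  independent_RVs W /\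
  forall k (A : set R), measurable A ->
    distribution P (W k) A = distribution P0 W0 A.

(* Given sigma(P_1, P_2, ...), the n balls X 0, ..., X (n-1) are independent
   with P(X i = j | P_1, P_2, ...) = P_{j+1}: the conditional probability of
   {X i = j i for all i} is tested by integration over every event B of the
   conditioning sigma-algebra. *)
Definition sieve_allocation (W : nat -> {RV P >-> R}) (n : nat)
    (X : 'I_n -> {RV P >-> nat}) : Prop :=
  forall (B : set T) (j : 'I_n -> nat),
    sigma_generated [set: nat] (box_prob W) B ->
    P (B `&` [set w | forall i, X i w = j i]) =
      (\int[P]_(w in B) (\prod_(i < n) box_prob W (j i) w)%:E)%E.

Definition occupied_boxes n (X : 'I_n -> {RV P >-> nat}) (w : T) : nat :=
  size (undup [seq X i w | i <- enum 'I_n]).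

Definition last_occupied_box n (X : 'I_n -> {RV P >-> nat}) (w : T) : nat :=
  \max_(i < n) (X i w).+1.

Definition empty_boxes n (X : 'I_n -> {RV P >-> nat}) (w : T) : nat :=
  (last_occupied_box X w - occupied_boxes X w)%N.

End BernoulliSieve.

(* Main.v *)
Require Import Defs.
From HB Require Import structures.
From mathcomp Require Import all_boot all_order all_algebra.
From mathcomp Require Import all_classical all_reals all_analysis.
From mathcomp Require Import measurable_realfun.
From mathcomp Require Import ring lra zify.

Set Implicit Arguments.
Unset Strict Implicit.
Unset Printing Implicit Defensive.

Import Order.TTheory GRing.Theory Num.Theory.
Import numFieldNormedType.Exports.

Local Open Scope classical_set_scope.
Local Open Scope ring_scope.

(** Write L_n for the number of empty boxes.  The theorem holds because each
    L_n is itself a Poisson mixture, and Poisson mixtures are closed under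
    convergence in distribution to a proper limit.  A law on the naturals is
    a Poisson mixture exactly when s |-> E (1 - s) ^ L is the Laplace
    transform of a law on the half-line, so everything is done on transforms.

    Follow the set D of balls that lie beyond the first k boxes as k grows.
    From D it passes to a subset A with probability
    E [W ^ |A| * (1 - W) ^ |D \ A|], and a box is empty inside the occupancy
    range exactly when the chain stays at a nonempty D ([empty_boxes_levels]).
    Hence E (1 - s) ^ L_n is the value f(D) at the full set of the solution of
    a linear system ([pgf_empty_boxes], [chain_limit_solve]):
    (p + s * w) * f(D) is a positive combination of the f(A) over proper
    subsets A of D, where w = E W ^ |D| and p = 1 - w.  Since 1 / (p + s * w)
    is a multiple of the Laplace transform of an exponential variable, and
    Laplace transforms of measures are stable under sums, nonnegative multiples
    and products, induction on D shows that f(D) is a Laplace transform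
    ([laplace_mixture_empty_boxes]).  Probabilistically: the sojourn at D is
    geometric, and geometric laws mix Poisson laws over exponential ones.

    For the limit, let Y_n = exp (- x) where x has the n-th mixing law.  Along
    an ultrafilter all tail probabilities of Y_n converge, and the generalized
    inverse of the limit is a [0, 1]-valued function Y of a uniform variable
    with E Y ^ s = lim E (1 - s) ^ L_n for 0 < s < 1
    ([laplace_mixture_compact]).  Mass of the mixing laws that escapes to
    infinity is collected by the event Y = 0.  Comparing coefficients of
    generating functions gives P(L = k) = E [Y > 0; e ^ (- lambda) *
    lambda ^ k / k!] with lambda = - ln Y; summing over k, properness of L
    yields P(Y > 0) = 1, so that L has the law of a Poisson variable with
    random mean lambda ([mixed_Poisson_pgf]).

    A mixed Poisson law is asked to be realized on a probability space carrying
    a Poisson process.  Splitting a sequence of fair coins into its even and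
    odd terms gives an exponential variable and an independent sequence of the
    same law; iterating yields i.i.d. exponential gaps
    ([exponential_interarrivals]), whose partial sums have the Erlang laws, and
    the product with the unit interval carries the independent time lambda. *)

(** * Integrals as limits of sums over level sets *)

(** The sum counts the positive integers up to [m] that are at most [y];
    together with the next lemma it brackets [y] between such a count and the
    strict count plus one. *)
Lemma grid_count_le (R : realType) (m : nat) (y : R) : 0 <= y ->
  \sum_(i < m) ((i.+1%:R <= y :> R)%R : nat)%:R <= y.
Proof.
move=> y0; elim: m => [|m IH]; first by rewrite big_ord0.
rewrite big_ord_recr /=; case: (leP m.+1%:R y) => my; last by rewrite addr0.
apply: le_trans my; rewrite -natr1 lerD2r.
rewrite -[leRHS](_ : \sum_(i < m) 1 = _) ?ler_sum// => [i _|].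
  by rewrite lern1 leq_b1.
by rewrite sumr_const card_ord.
Qed.

Lemma grid_count_gt (R : realType) (m : nat) (y : R) : y <= m%:R ->
  y <= \sum_(i < m) ((i.+1%:R < y :> R)%R : nat)%:R + 1.
Proof.
elim: m => [|m IH] ym; first by rewrite big_ord0 add0r (le_trans ym).
rewrite big_ord_recr /=; have [{}/IH ym'|my] := leP y m%:R.
  by rewrite (le_trans ym')// lerD2r lerDl.
rewrite (le_trans ym)// -natr1 lerD2r.
rewrite -[leLHS]addr0 lerD// -[leLHS](_ : \sum_(i < m) 1 = _).
  apply: ler_sum => i _; rewrite (le_lt_trans _ my)//.
  by rewrite ler_nat.
by rewrite sumr_const card_ord.
Qed.

Lemma grid_le (R : realType) (m : nat) (z : R) : (0 < m)%N -> 0 <= z ->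
  m%:R^-1 * \sum_(i < m) ((i.+1%:R / m%:R <= z :> R)%R : nat)%:R <= z.
Proof.
move=> m0 z0; have m0R : 0 < m%:R :> R by rewrite ltr0n.
rewrite ler_pdivrMl//.
under eq_bigr do rewrite ler_pdivrMr// [_ * _]mulrC.
by apply: grid_count_le; rewrite mulr_ge0// ltW.
Qed.

Lemma grid_gt (R : realType) (m : nat) (z : R) : (0 < m)%N -> z <= 1 ->
  z <= m%:R^-1 + m%:R^-1 * \sum_(i < m) ((i.+1%:R / m%:R < z :> R)%R : nat)%:R.
Proof.
move=> m0 z1; have m0R : 0 < m%:R :> R by rewrite ltr0n.
rewrite -{1}[m%:R^-1]mulr1 -mulrDr ler_pdivlMl// [1 + _]addrC.
under eq_bigr do rewrite ltr_pdivrMr// [z * _]mulrC.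
by apply: grid_count_gt; rewrite ler_piMr// ltW.
Qed.

Lemma measurable_ge_set d (T : measurableType d) (R : realType) (Z : T -> R) (q : R) :
  measurable_fun setT Z -> measurable [set w | q <= Z w].
Proof.
move=> mZ; rewrite -[X in measurable X]setTI.
have -> : [set w | q <= Z w] = Z @^-1` `[q, +oo[%classic.
  by apply/seteqP; split => w /=; rewrite in_itv/= andbT.
exact: mZ.
Qed.

Lemma measurable_gt_set d (T : measurableType d) (R : realType) (Z : T -> R) (q : R) :
  measurable_fun setT Z -> measurable [set w | q < Z w].
Proof.
move=> mZ; rewrite -[X in measurable X]setTI.
have -> : [set w | q < Z w] = Z @^-1` `]q, +oo[%classic.
  by apply/seteqP; split => w /=; rewrite in_itv/= andbT.
exact: mZ.
Qed.

Lemma integral_grid d (T : measurableType d) (R : realType)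
  (mu : {measure set T -> \bar R}) (m : nat) (A : 'I_m -> set T) :
  (forall i, measurable (A i)) ->
  (\int[mu]_w (m%:R^-1 * \sum_(i < m) \1_(A i) w)%:E =
   (m%:R^-1)%:E * \sum_(i < m) mu (A i))%E.
Proof.
move=> mA; under eq_integral do rewrite EFinM.
rewrite ge0_integralZl//=; last 2 first.
- apply/measurable_EFinP; apply: measurable_sum => i; exact: measurable_indic.
- by move=> w _; rewrite lee_fin sumr_ge0.
- congr (_ * _)%E; under eq_integral do rewrite -sumEFin.
  rewrite ge0_integral_sum//.
  + by apply: eq_bigr => i _; rewrite integral_indic// setIT.
  + by move=> i; apply/measurable_EFinP; exact: measurable_indic.
Qed.

(** With the next lemma, this brackets an integral by Riemann sums of the tail
    function.  The non-strict levels appear in the lower bound and the strict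
    ones in the upper bound, so the two can be compared across different
    measures even when the tail functions jump. *)
Lemma integral_grid_le d (T : measurableType d) (R : realType)
  (mu : {measure set T -> \bar R}) (Z : T -> R) (m : nat) :
  (0 < m)%N -> measurable_fun setT Z -> (forall w, 0 <= Z w) ->
  ((m%:R^-1)%:E * \sum_(i < m) mu [set w | (i.+1%:R / m%:R <= Z w)%R] <=
    \int[mu]_w (Z w)%:E)%E.
Proof.
move=> m0 mZ Z0; rewrite -integral_grid; last first.
  by move=> i; exact: measurable_ge_set.
apply: ge0_le_integral => //.
- by move=> w _; rewrite lee_fin mulr_ge0 ?invr_ge0// sumr_ge0.
- apply/measurable_EFinP; apply: measurable_funM => //.
  by apply: measurable_sum => i; apply: measurable_indic; exact: measurable_ge_set.
- exact/measurable_EFinP.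
- move=> w _; rewrite lee_fin; apply: le_trans (grid_le m0 (Z0 w)).
  by under eq_bigr do rewrite indicE mem_setE.
Qed.

Lemma integral_grid_gt d (T : measurableType d) (R : realType)
  (mu : {measure set T -> \bar R}) (Z : T -> R) (m : nat) :
  (0 < m)%N -> measurable_fun setT Z -> (forall w, 0 <= Z w <= 1) ->
  (\int[mu]_w (Z w)%:E <= (m%:R^-1)%:E * mu setT +
   (m%:R^-1)%:E * \sum_(i < m) mu [set w | (i.+1%:R / m%:R < Z w)%R])%E.
Proof.
move=> m0 mZ Z01; rewrite -integral_grid; last first.
  by move=> i; exact: measurable_gt_set.
rewrite -(integral_cst mu measurableT ((m%:R^-1)%:E)) -ge0_integralD//=; last 2 first.
- by move=> w _; rewrite lee_fin mulr_ge0 ?invr_ge0// sumr_ge0.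
- apply/measurable_EFinP; apply: measurable_funM => //.
  by apply: measurable_sum => i; apply: measurable_indic; exact: measurable_gt_set.
apply: ge0_le_integral => //.
- by move=> w _; rewrite lee_fin; have /andP[] := Z01 w.
- exact/measurable_EFinP.
- apply: emeasurable_funD => //; apply/measurable_EFinP.
  apply: measurable_funM => //.
  by apply: measurable_sum => i; apply: measurable_indic; exact: measurable_gt_set.
- move=> w _; rewrite -EFinD lee_fin.
  have /andP[_ Z1] := Z01 w; apply: le_trans (grid_gt m0 Z1) _.
  by under [in leRHS]eq_bigr do rewrite indicE mem_setE.
Qed.

Lemma le_of_inv_nat (R : realType) (x y c : \bar R) : (0 <= c < +oo)%E ->
  (forall m : nat, (0 < m)%N -> (x <= y + (m%:R^-1)%:E * c)%E) -> (x <= y)%E.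
Proof.
move=> /andP[]; case: c => [c|//|//]; rewrite lee_fin => c0 _ h.
apply/lee_addgt0Pr => e e0.
pose m := (Num.truncn (c / e)).+1.
apply: le_trans (h m isT) _; rewrite leeD2l// -EFinM lee_fin.
rewrite ler_pdivrMl ?ltr0n// mulrC -ler_pdivrMl// mulrC.
by rewrite ltW// truncnS_gt// divr_ge0// ltW.
Qed.

(** Change of variables.  The hypothesis is the conclusion for indicators; the
    grid brackets extend it to bounded functions, with an error at most the
    total mass divided by the mesh size. *)
Lemma integral_image_density d d' (T : measurableType d)
  (T' : measurableType d') (R : realType) (mu : {measure set T -> \bar R})
  (nu : {measure set T' -> \bar R}) (X : T -> T') (G : T -> R) :
  measurable_fun setT X -> measurable_fun setT G -> (forall w, 0 <= G w) ->
  (nu setT < +oo)%E ->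
  (forall A, measurable A -> nu A = \int[mu]_w (G w * \1_A (X w))%:E)%E ->
  forall f : T' -> R, measurable_fun setT f -> (forall y, 0 <= f y <= 1) ->
    (\int[nu]_y (f y)%:E = \int[mu]_w (G w * f (X w))%:E)%E.
Proof.
move=> mX mG G0 fnu nuE f mf f01.
have f0 y : 0 <= f y by have /andP[] := f01 y.
have mfX : measurable_fun setT (fun w => f (X w)) by exact: measurableT_comp.
have mGf : measurable_fun setT (fun w => (G w * f (X w))%:E).
  by apply/measurable_EFinP; exact: measurable_funM.
have weighted m (A : 'I_m -> set T') : (forall i, measurable (A i)) ->
    ((m%:R^-1)%:E * \sum_(i < m) nu (A i) =
     \int[mu]_w (G w * (m%:R^-1 * \sum_(i < m) \1_(A i) (X w)))%:E)%E.
  move=> mA.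
  have mGA i : measurable_fun setT (fun w => (G w * \1_(A i) (X w))%:E).
    apply/measurable_EFinP; apply: measurable_funM => //.
    by apply: measurableT_comp => //; exact: measurable_indic.
  transitivity (\int[mu]_w ((m%:R^-1)%:E *
      \sum_(i < m) (G w * \1_(A i) (X w))%:E))%E.
    rewrite ge0_integralZl//; last 2 first.
    - exact: emeasurable_sum.
    - by move=> w _; apply: sume_ge0 => i _; rewrite lee_fin mulr_ge0.
    rewrite ge0_integral_sum//; last first.
      by move=> i w _; rewrite lee_fin mulr_ge0.
    by congr (_ * _)%E; apply: eq_bigr => i _; rewrite nuE.
  by apply: eq_integral => w _; rewrite sumEFin -EFinM -mulr_sumr mulrCA.

have mavg m (A : 'I_m -> set T') : (forall i, measurable (A i)) ->
    measurable_fun setT (fun w => G w * (m%:R^-1 * \sum_(i < m) \1_(A i) (X w))).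
  move=> mA; apply: measurable_funM => //; apply: measurable_funM => //.
  apply: measurable_sum => i.
  by apply: measurableT_comp => //; exact: measurable_indic.
have lower m : (0 < m)%N -> ((m%:R^-1)%:E *
    \sum_(i < m) nu [set y | (i.+1%:R / m%:R <= f y)%R] <=
    \int[mu]_w (G w * f (X w))%:E)%E.
  move=> m0; rewrite weighted; last by move=> i; exact: measurable_ge_set.
  apply: ge0_le_integral => //.
  - by move=> w _; rewrite lee_fin !mulr_ge0 ?invr_ge0// sumr_ge0.
  - apply/measurable_EFinP; apply: mavg => i; exact: measurable_ge_set.
  - move=> w _; rewrite lee_fin ler_wpM2l//.
    apply: le_trans (grid_le m0 (f0 (X w))).
    by under eq_bigr do rewrite indicE mem_setE.
have upper m : (0 < m)%N -> (\int[mu]_w (G w * f (X w))%:E <=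
    (m%:R^-1)%:E * nu setT +
    (m%:R^-1)%:E * \sum_(i < m) nu [set y | (i.+1%:R / m%:R < f y)%R])%E.
  move=> m0; rewrite weighted; last by move=> i; exact: measurable_gt_set.
  have mGm : measurable_fun setT (fun w => (m%:R^-1 * G w)%:E).
    by apply/measurable_EFinP; exact: measurable_funM.
  have -> : ((m%:R^-1)%:E * nu setT = \int[mu]_w (m%:R^-1 * G w)%:E)%E.
    rewrite nuE//; under eq_integral do rewrite indicT mulr1.
    under [RHS]eq_integral do rewrite EFinM.
    by rewrite ge0_integralZl//; [exact/measurable_EFinP|
      move=> w _; rewrite lee_fin].
  rewrite -ge0_integralD//; last 3 first.
  - by move=> w _; rewrite lee_fin mulr_ge0 ?invr_ge0.
  - by move=> w _; rewrite lee_fin !mulr_ge0 ?invr_ge0// sumr_ge0.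
  - apply/measurable_EFinP; apply: mavg => i; exact: measurable_gt_set.
  apply: ge0_le_integral => //.
  - by move=> w _; rewrite lee_fin mulr_ge0.
  - apply: emeasurable_funD => //.
    apply/measurable_EFinP; apply: mavg => i; exact: measurable_gt_set.
  - move=> w _; rewrite -EFinD lee_fin [m%:R^-1 * _]mulrC -mulrDr ler_wpM2l//.
    have /andP[_ f1] := f01 (X w); apply: le_trans (grid_gt m0 f1) _.
    by under [in leRHS]eq_bigr do rewrite indicE mem_setE.
have ltle m : (\sum_(i < m) nu [set y | (i.+1%:R / m%:R < f y)%R] <=
    \sum_(i < m) nu [set y | (i.+1%:R / m%:R <= f y)%R])%E.
  apply: lee_sum => i _; apply: le_measure.
  - by rewrite inE; exact: measurable_gt_set.
  - by rewrite inE; exact: measurable_ge_set.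
  - by move=> y /= /ltW.
have nu01 : (0 <= nu setT < +oo)%E by rewrite fnu measure_ge0.
apply/eqP; rewrite eq_le; apply/andP; split; apply: (le_of_inv_nat nu01) => m m0.
- apply: le_trans (integral_grid_gt _ m0 mf f01) _.
  rewrite addeC leeD2r//; apply: le_trans (lower _ m0).
  by rewrite lee_wpmul2l// lee_fin invr_ge0.
- apply: le_trans (upper _ m0) _.
  rewrite addeC leeD2r//; apply: le_trans (integral_grid_le _ m0 mf f0).
  by rewrite lee_wpmul2l// lee_fin invr_ge0.
Qed.

(** * Laplace transforms of measures on the half-line *)

(** [phi] agrees on [0, 1] with the Laplace transform of a measure on the
    half-line.  The measure lives on the whole line and is read through
    [`|x|], which spares a support condition. *)
Definition laplace_mixture (R : realType) (phi : R -> R) : Prop :=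
  exists mu : {measure set R -> \bar R}, forall s : R, 0 <= s <= 1 ->
    (\int[mu]_x (expR (- (s * `|x|)))%:E = (phi s)%:E)%E.

Lemma measurable_exp_abs (R : realType) (s : R) :
  measurable_fun [set: R] (fun x : R => expR (- (s * `|x|))).
Proof.
apply: measurableT_comp => //; apply: measurableT_comp => //.
exact: measurable_funM.
Qed.

Lemma measurable_Eexp_abs (R : realType) (s : R) :
  measurable_fun [set: R] (fun x : R => (expR (- (s * `|x|)))%:E).
Proof. by apply/measurable_EFinP; exact: measurable_exp_abs. Qed.

Lemma laplace_mixture_ext (R : realType) (phi psi : R -> R) :
  (forall s : R, 0 <= s <= 1 -> phi s = psi s) ->
  laplace_mixture phi -> laplace_mixture psi.
Proof. by move=> e [mu h]; exists mu => s s01; rewrite h// e. Qed.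

Lemma laplace_mixture_mass (R : realType) (phi : R -> R)
  (mu : {measure set R -> \bar R}) : (forall s : R, 0 <= s <= 1 ->
    (\int[mu]_x (expR (- (s * `|x|)))%:E = (phi s)%:E)%E) ->
  mu setT = (phi 0)%:E.
Proof.
move=> h; rewrite -h ?lexx ?ler01//.
under eq_integral do rewrite mul0r oppr0 expR0.
by rewrite integral_cst// mul1e.
Qed.

Lemma laplace_mixture0 (R : realType) : laplace_mixture (fun _ : R => 0).
Proof. by exists mzero => s _; rewrite integral_measure_zero. Qed.

Lemma laplace_mixtureD (R : realType) (phi psi : R -> R) :
  laplace_mixture phi -> laplace_mixture psi ->
  laplace_mixture (fun s => phi s + psi s).
Proof.
move=> [mu hmu] [nu hnu]; exists (measure_add mu nu) => s s01.
rewrite ge0_integral_measure_add//.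
- by rewrite hmu// hnu.
- exact: measurable_Eexp_abs.
Qed.

Lemma laplace_mixtureZ (R : realType) (c : R) (phi : R -> R) : 0 <= c ->
  laplace_mixture phi -> laplace_mixture (fun s => c * phi s).
Proof.
move=> c0 [mu hmu]; exists (mscale (NngNum c0) mu) => s s01.
rewrite ge0_integral_mscale//.
- by rewrite hmu.
- exact: measurable_Eexp_abs.
Qed.

Lemma laplace_mixture_sum (R : realType) (I : Type) (r : seq I) (Q : pred I)
  (F : I -> R -> R) : (forall i, Q i -> laplace_mixture (F i)) ->
  laplace_mixture (fun s => \sum_(i <- r | Q i) F i s).
Proof.
move=> hF; elim: r => [|i r IH].
  by apply: laplace_mixture_ext (laplace_mixture0 R) => s _; rewrite big_nil.
have [Qi|nQi] := boolP (Q i).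
  apply: laplace_mixture_ext (laplace_mixtureD (hF i Qi) IH) => s _.
  by rewrite big_cons Qi.
by apply: laplace_mixture_ext IH => s _; rewrite big_cons (negbTE nQi).
Qed.

(** Existence statements for measures hide the measure built, so that
    later rewriting sees only its characteristic property. *)
Lemma image_measureP d d' (T : measurableType d) (T' : measurableType d')
  (R : realType) (m : {measure set T -> \bar R}) (f : T -> T') :
  measurable_fun setT f ->
  exists nu : {measure set T' -> \bar R}, forall g : T' -> \bar R,
    measurable_fun setT g -> (forall y, 0 <= g y)%E ->
    (\int[nu]_y g y = \int[m]_x g (f x))%E.
Proof.
move=> mf; unshelve eexists; first exact: (pushforward m f).
by move=> g mg g0; rewrite ge0_integral_pushforward// preimage_setT.
Qed.

Lemma finite_measureP d (T : measurableType d) (R : realType)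
  (m : {measure set T -> \bar R}) : (m setT < +oo)%E ->
  exists m' : {finite_measure set T -> \bar R}, m = m' :> {measure set T -> \bar R}.
Proof.
move=> /lty_fin_num_fun fm.
pose H1 := isFinite.Build _ _ _ (Measure.sort m) fm.
have sm : sigma_finite setT m.
  by apply: fin_num_fun_sigma_finite => //; rewrite measure0.
pose H2 := isSFinite.Build _ _ _ (Measure.sort m) (sfinite_measure_sigma_finite sm).
pose H3 := isSigmaFinite.Build _ _ _ (Measure.sort m) sm.
pose m' := HB.pack_for (FiniteMeasure.type T R) (Measure.sort m) H1 H2 H3.
by exists m'; exact: eq_measure.
Qed.

(** The product of two transforms is the transform of the image of the product
    measure under addition. *)
Lemma laplace_mixtureM (R : realType) (phi psi : R -> R) :
  laplace_mixture phi -> laplace_mixture psi ->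
  laplace_mixture (fun s => phi s * psi s).
Proof.
move=> [mu hmu] [nu hnu].
have [|mu' emu] := @finite_measureP _ _ _ mu.
  by rewrite (laplace_mixture_mass hmu) ltry.
have [|nu' enu] := @finite_measureP _ _ _ nu.
  by rewrite (laplace_mixture_mass hnu) ltry.
rewrite {}emu in hmu; rewrite {}enu in hnu.
pose add_abs (z : R * R) := `|z.1| + `|z.2|.
have madd : measurable_fun setT add_abs.
  by apply: measurable_funD; apply: measurableT_comp.
have [lam lamE] := image_measureP (mu' \x nu')%E madd.
exists lam => s s01; rewrite lamE; last 2 first.
- exact: measurable_Eexp_abs.
- by move=> x; rewrite lee_fin expR_ge0.
rewrite fubini_tonelli1//=; last first.
  exact: (measurableT_comp (measurable_Eexp_abs s) madd).
rewrite /fubini_F/=.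
transitivity (\int[mu']_x ((expR (- (s * `|x|)))%:E * (psi s)%:E))%E.
  apply: eq_integral => x _; rewrite -hnu// -ge0_integralZl//; last first.
    exact: measurable_Eexp_abs.
  apply: eq_integral => y _.
  by rewrite ger0_norm ?addr_ge0// mulrDr opprD expRD EFinM.
rewrite ge0_integralZr//; last 2 first.
- exact: measurable_Eexp_abs.
- by rewrite -hnu//; apply: integral_ge0 => x _; rewrite lee_fin expR_ge0.
by rewrite hmu// EFinM.
Qed.

Lemma integral_exponential_law (R : realType) (r : R)
  (nu : {measure set R -> \bar R}) : 0 < r ->
  (forall A, measurable A -> nu A = exponential_prob r A) ->
  forall f : R -> R, measurable_fun setT f -> (forall y, 0 <= f y <= 1) ->
    (\int[nu]_y (f y)%:E =
     \int[lebesgue_measure]_x (exponential_pdf r x * f x)%:E)%E.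
Proof.
move=> r0 nuE.
apply: (@integral_image_density _ _ _ _ _ lebesgue_measure nu id
  (exponential_pdf r)).
- exact: measurable_id.
- exact: measurable_exponential_pdf.
- by move=> x; apply: exponential_pdf_ge0; exact: ltW.
- by rewrite nuE// /exponential_prob integral_exponential_pdf// ltry.
- move=> A mA; rewrite nuE// /exponential_prob [LHS]integral_mkcond.
  apply: eq_integral => x _; rewrite patchE indicE.
  by case: ifPn => _; rewrite ?mulr1 ?mulr0.
Qed.

Lemma exponential_lawP (R : realType) (r : R) : 0 < r ->
  exists nu : {measure set R -> \bar R}, forall A, nu A = exponential_prob r A.
Proof.
move=> r0.
have mid : measurable_fun (setT : set (measurableTypeR R)) (fun x => x : R).
  exact: measurable_id.
pose m : {measure set (measurableTypeR R) -> \bar R} :=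
  exponential_distribution_exponential_prob__canonical__measure_function_Measure r0.
by unshelve eexists; first exact: (pushforward m (fun x => x : R)).
Qed.

(** With c = w / p, this is 1 / p times the transform of c * e for a standard
    exponential variable e. *)
Lemma laplace_mixture_exponential (R : realType) (p w : R) : 0 < p -> 0 <= w ->
  laplace_mixture (fun s => (p + s * w)^-1).
Proof.
move=> p0 w0; pose c := w / p.
have c0 : 0 <= c by rewrite divr_ge0// ltW.
apply: (@laplace_mixture_ext _ (fun s => p^-1 * (1 + s * c)^-1)).
  move=> s /andP[s0 _]; rewrite -invfM mulrDr mulr1 mulrCA /c.
  by rewrite [p * _]mulrC divfK// gt_eqF.
apply: laplace_mixtureZ; first by rewrite invr_ge0 ltW.
have msc : measurable_fun setT (fun x : R => c * x) by exact: measurable_funM.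
have [nu nuE] := exponential_lawP (@ltr01 R).
have [lam lamE] := image_measureP nu msc.
exists lam => s /andP[s0 s1]; rewrite lamE; last 2 first.
- exact: measurable_Eexp_abs.
- by move=> x; rewrite lee_fin expR_ge0.
rewrite (@integral_exponential_law _ 1 nu) //; last 2 first.
- exact: (measurableT_comp (measurable_exp_abs s) msc).
- move=> y; rewrite expR_ge0/= -expR0 ler_expR lerNl oppr0.
  by rewrite mulr_ge0.
have r0 : 0 < 1 + s * c by rewrite ltr_pwDl// mulr_ge0.
transitivity (\int[lebesgue_measure]_x
   ((1 + s * c)^-1%:E * (exponential_pdf (1 + s * c) x)%:E))%E.
  apply: eq_integral => x _; rewrite -EFinM; congr EFin.
  have [x0|x0] := ltP x 0; first by rewrite !lt0_exponential_pdf// mul0r mulr0.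
  rewrite !exponential_pdfE//.
  rewrite mul1r mulKf ?gt_eqF// -expRD; congr expR.
  have cx0 : 0 <= c * (x : R) by rewrite mulr_ge0.
  by rewrite (ger0_norm cx0); ring.
rewrite ge0_integralZl//.
- by rewrite integral_exponential_pdf// mule1.
- by apply/measurable_EFinP; exact: measurable_exponential_pdf.
- by move=> x _; rewrite lee_fin exponential_pdf_ge0// ltW.
- by rewrite lee_fin invr_ge0 ltW.
Qed.

(** * Compactness of Laplace transforms of laws *)

Lemma ultra_fmap (T U : Type) (f : T -> U) (F : set_system T) :
  UltraFilter F -> UltraFilter (f @ F).
Proof.
move=> UF; split; first exact: fmap_proper_filter.
move=> G PG FG; apply/seteqP; split => //= A GA.
have [//|FnA] := in_ultra_setVsetC (f @^-1` A) UF.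
have : G (~` A) by exact: FG.
move=> GnA; have := filterI GA GnA; rewrite setICr => G0.
by have [] := @filter_not_empty _ G PG (G0 _).
Qed.

(** Ultrafilters replace the extraction of subsequences: a single ultrafilter
    makes uncountably many bounded sequences converge at once. *)
Lemma ultra_cvg_segment (R : realType) (F : set_system nat) (u : nat -> R) (a b : R) :
  UltraFilter F -> (forall n, a <= u n <= b) ->
  exists l, a <= l <= b /\ u n @[n --> F] --> l.
Proof.
move=> UF uab; have := @segment_compact R a b.
rewrite compact_ultra => /(_ _ (ultra_fmap u UF)) [|l [lab ul]].
  have : \forall n \near F, a <= u n <= b by apply: nearW.
  by rewrite near_simpl; apply: filterS => n; rewrite /= in_itv.
by exists l; split => //; move: lab; rewrite /= in_itv.
Qed.

Lemma lt_powR (R : realType) (s q a : R) : 0 < s -> 0 <= q -> 0 <= a ->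
  (q < a `^ s) = (q `^ s^-1 < a).
Proof.
move=> s0 q0 a0; have sp : 0 <= s by exact: ltW.
have qE : q = (q `^ s^-1) `^ s.
  by rewrite -powRrM mulVf ?gt_eqF// powRr1.
apply/idP/idP => h.
  rewrite ltNge; apply/negP => aq; move: h; apply/negP; rewrite -leNgt [leRHS]qE.
  by apply: ge0_ler_powR => //; rewrite nnegrE// powR_ge0.
by rewrite [ltLHS]qE; apply: gt0_ltr_powR => //; rewrite nnegrE// powR_ge0.
Qed.

Lemma le_powR (R : realType) (s q a : R) : 0 < s -> 0 <= q -> 0 <= a ->
  (q <= a `^ s) = (q `^ s^-1 <= a).
Proof.
move=> s0 q0 a0; rewrite leNgt [RHS]leNgt; congr negb.
have s'0 : 0 < s^-1 by rewrite invr_gt0.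
by rewrite [RHS]lt_powR// ?powR_ge0// invrK.
Qed.

Lemma powR_le1 (R : realType) (a s : R) : 0 <= s -> 0 <= a <= 1 ->
  0 <= a `^ s <= 1.
Proof.
move=> s0 /andP[a0 a1]; rewrite powR_ge0/=.
have <- : 1 `^ s = 1 :> R by rewrite powR1.
by apply: ge0_ler_powR; rewrite ?nnegrE.
Qed.

(** [Y] is the generalized inverse of the nonincreasing [G].  As
    [G] may jump, [u <= G y] and [y <= Y u] are equivalent only up to
    replacing one weak inequality by a strict one, which the grid estimates
    tolerate. *)
Lemma upper_threshold (R : realType) (G : R -> R) :
  (forall x y, x <= y -> G y <= G x) ->
  exists Y : R -> R,
    [/\ {homo Y : u v /~ u <= v}, forall u, 0 <= Y u <= 1,
      forall u y : R, 0 <= y <= 1 -> u <= G y -> y <= Y u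
    & forall u y : R, 0 <= y -> y < Y u -> u <= G y].
Proof.
move=> niG; pose S u := [set y | y = 0 \/ (0 <= y <= 1 /\ u <= G y)].
have S0 u : S u !=set0 by exists 0; left.
have S1 u : ubound (S u) 1 by move=> y [->|[/andP[]]].
have hS u : has_sup (S u) by split => //; exists 1.
exists (fun u => sup (S u)); split.
- move=> u v vu; apply: sup_le_ub => // y [->|[y01 Gy]].
    by apply: ub_le_sup; [exists 1|left].
  by apply: ub_le_sup; [exists 1|right; split => //; exact: le_trans Gy].
- move=> u; apply/andP; split; last exact: sup_le_ub.
  by apply: ub_le_sup; [exists 1|left].
- by move=> u y y01 uG; apply: ub_le_sup; [exists 1|right].
- move=> u y y0 /(sup_gt (S0 u))[z [->|[z01 uz]] yz].
    by move: yz; rewrite ltNge y0.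
  by apply: le_trans uz _; apply: niG; exact: ltW.
Qed.

(** A Helly selection theorem.  Here [e x = expR (- `|x|)], so that [phi n s]
    is the [s]-th moment of [e] under the [n]-th mixing law, and [G] is the
    limit of the tail functions of [e] along an ultrafilter.  The generalized
    inverse [Y] of [G] turns the uniform law into a law with tail function [G]
    up to jumps.  Both [psi s] and the integral of [Y u `^ s] lie between the
    same Riemann sums of [G], hence are equal.  Positivity of [s] makes
    the levels of [Y u `^ s] levels of [Y u]; mass of the mixing laws that
    escapes to infinity becomes mass of the event [Y u = 0]. *)
Lemma laplace_mixture_compact (R : realType) (phi : nat -> R -> R) (psi : R -> R)
  (nu : {measure set R -> \bar R}) :
  (forall n, laplace_mixture (phi n)) -> (forall n, phi n 0 = 1) ->
  (forall s : R, 0 < s < 1 -> phi n s @[n --> \oo] --> psi s) ->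
  nu setT = 1%E ->
  (forall a : R, 0 <= a <= 1 -> nu `]-oo, a]%classic = a%:E) ->
  exists Y : R -> R, [/\ measurable_fun setT Y, forall u, 0 <= Y u <= 1 &
    forall s : R, 0 < s < 1 -> (\int[nu]_u (Y u `^ s)%:E = (psi s)%:E)%E].
Proof.
move=> /choice[mu muE] phi0 cphi nu1 nuE.
have [U [UU oU]] := @ultraFilterLemma _ (\oo : set_system nat) _.
have mass n : mu n setT = 1%E by rewrite (laplace_mixture_mass (muE n)) phi0.
pose e (x : R) := expR (- `|x|).
have me : measurable_fun setT e.
  by apply: measurableT_comp => //; exact: measurableT_comp.
pose g n y := fine (mu n [set x | y < e x]).
have le1 n A : measurable A -> (mu n A <= 1)%E.
  by move=> mA; rewrite -(mass n) le_measure// inE.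
have mset y : measurable [set x | y < e x] by exact: measurable_gt_set.
have gE n y : (g n y)%:E = mu n [set x | y < e x].
  rewrite /g fineK// ge0_fin_numE// (le_lt_trans (le1 n _ (mset y)))//.
  by rewrite ltry.
have g01 n y : 0 <= g n y <= 1 by rewrite -!lee_fin gE measure_ge0 le1.
have /choice[G GP] : forall y, exists l : R, 0 <= l <= 1 /\ g n y @[n --> U] --> l.
  by move=> y; exact: (ultra_cvg_segment UU (g01^~ y)).
have G01 y : 0 <= G y <= 1 by have [] := GP y.
have niG x y : x <= y -> G y <= G x.
  move=> xy; apply: (@ler_cvg_to _ U _ _ _ _ _ _ (GP y).2 (GP x).2).
  apply: nearW => n; rewrite -lee_fin !gE le_measure ?inE//.
  by move=> z /=; exact: le_lt_trans.

have [Y [niY Y01 GY YG]] := upper_threshold niG.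
have mY : measurable_fun setT Y.
  by apply: nonincreasing_measurable => // a b; exact: niY.
exists Y; split => // s s01.
have /andP[s0 s1] := s01.
pose r m (i : 'I_m) : R := (i.+1%:R / m%:R) `^ s^-1.
have q01 m (i : 'I_m) : 0 <= (i.+1%:R / m%:R : R) <= 1.
  rewrite divr_ge0//= ler_pdivrMr ?mul1r ?ler_nat//.
  by rewrite ltr0n (leq_ltn_trans _ (ltn_ord i)).
have r01 m (i : 'I_m) : 0 <= r m i <= 1.
  by apply: powR_le1 (q01 m i); rewrite invr_ge0 ltW.
have ZE x : expR (- (s * `|x|)) = e x `^ s.
  by rewrite /e -expRM mulNr mulrC.
have e0 x : 0 <= e x by exact: expR_ge0.
have phi_lo m n : (0 < m)%N -> m%:R^-1 * \sum_(i < m) g n (r m i) <= phi n s.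
  move=> m0; rewrite -lee_fin -muE ?(ltW s0) ?(ltW s1)//.
  apply: le_trans (integral_grid_le _ m0 (measurable_exp_abs s) _); last first.
    by move=> x; exact: expR_ge0.
  rewrite EFinM lee_wpmul2l ?lee_fin ?invr_ge0//.
  rewrite -sumEFin; apply: lee_sum => i _; rewrite gE le_measure ?inE//.
    by apply: measurable_ge_set; exact: measurable_exp_abs.
  move=> x /= rx; have /andP[q0 _] := q01 m i.
  by rewrite ZE ltW// lt_powR.
have phi_up m n : (0 < m)%N ->
    phi n s <= m%:R^-1 + m%:R^-1 * \sum_(i < m) g n (r m i).
  move=> m0; rewrite -lee_fin -muE ?(ltW s0) ?(ltW s1)//.
  apply: le_trans (integral_grid_gt _ m0 (measurable_exp_abs s) _) _.
    move=> x; rewrite expR_ge0/= -expR0 ler_expR oppr_le0.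
    by rewrite mulr_ge0// ltW.
  rewrite mass mule1 EFinD EFinM leeD2l// lee_wpmul2l ?lee_fin ?invr_ge0//.
  rewrite -sumEFin; apply: lee_sum => i _; rewrite gE le_measure ?inE//.
    by apply: measurable_gt_set; exact: measurable_exp_abs.
  move=> x /=; have /andP[q0 _] := q01 m i.
  by rewrite ZE lt_powR.
have cg m : m%:R^-1 * \sum_(i < m) g n (r m i) @[n --> U] -->
    m%:R^-1 * \sum_(i < m) G (r m i).
  apply: cvgMr; apply: cvg_big; first exact: add_continuous.
  by move=> i _; have [] := GP (r m i).
have cphiU : phi n s @[n --> U] --> psi s.
  by apply: cvg_trans (cphi _ s01) => A /=; apply: oU.
have psi_lo m : (0 < m)%N -> m%:R^-1 * \sum_(i < m) G (r m i) <= psi s.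
  move=> m0; apply: (@ler_cvg_to _ U _ _ _ _ _ _ (cg m) cphiU).
  by apply: nearW => n; exact: phi_lo.
have psi_up m : (0 < m)%N -> psi s <= m%:R^-1 + m%:R^-1 * \sum_(i < m) G (r m i).
  move=> m0.
  have cup : m%:R^-1 + m%:R^-1 * \sum_(i < m) g n (r m i) @[n --> U] -->
      m%:R^-1 + m%:R^-1 * \sum_(i < m) G (r m i).
    by apply: cvgD (cg m); exact: cvg_cst.
  apply: (@ler_cvg_to _ U _ _ _ _ _ _ cphiU cup).
  by apply: nearW => n; exact: phi_up.
have mYs : measurable_fun setT (fun u => Y u `^ s).
  exact: (measurableT_comp (measurable_powR s) mY).
have Ys01 u : 0 <= Y u `^ s <= 1.
  by apply: powR_le1 (Y01 u); exact: ltW.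
have mray a : measurable (`]-oo, a]%classic : set R) by exact: measurable_itv.
have int_lo m : (0 < m)%N ->
    ((m%:R^-1 * \sum_(i < m) G (r m i))%:E <= \int[nu]_u (Y u `^ s)%:E)%E.
  move=> m0; apply: le_trans (integral_grid_le _ m0 mYs _); last first.
    by move=> u; have /andP[] := Ys01 u.
  rewrite EFinM lee_wpmul2l ?lee_fin ?invr_ge0//.
  rewrite -sumEFin; apply: lee_sum => i _; rewrite -nuE// le_measure ?inE//.
    exact: measurable_ge_set.
  move=> u /=; rewrite in_itv/= => uG.
  have /andP[q0 _] := q01 m i; have /andP[Y0 _] := Y01 u.
  by rewrite le_powR//; exact: GY (r01 m i) uG.
have int_up m : (0 < m)%N -> (\int[nu]_u (Y u `^ s)%:E <=
    (m%:R^-1 + m%:R^-1 * \sum_(i < m) G (r m i))%:E)%E.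
  move=> m0; apply: le_trans (integral_grid_gt _ m0 mYs Ys01) _.
  rewrite nu1 mule1 EFinD EFinM leeD2l// lee_wpmul2l ?lee_fin ?invr_ge0//.
  rewrite -sumEFin; apply: lee_sum => i _; rewrite -nuE// le_measure ?inE//.
    exact: measurable_gt_set.
  move=> u /=; rewrite in_itv/=.
  have /andP[q0 _] := q01 m i; have /andP[Y0 _] := Y01 u.
  rewrite lt_powR//; have /andP[? _] := r01 m i; exact: YG.
apply/eqP; rewrite eq_le; apply/andP; split;
  apply: (@le_of_inv_nat _ _ _ 1%E); rewrite ?lte01 ?lee01 ?ltry//= => m m0.
- apply: le_trans (int_up _ m0) _.
  by rewrite mule1 -EFinD lee_fin addrC lerD2r psi_lo.
- apply: (@le_trans _ _ (m%:R^-1 + m%:R^-1 * \sum_(i < m) G (r m i))%:E).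
    by rewrite lee_fin psi_up.
  by rewrite mule1 EFinD addeC leeD2r// int_lo.
Qed.

(** * Expectations of products of independent variables *)

Section product_expectation.
Context d (T : measurableType d) (R : realType) (P : probability T R).
Variable W : nat -> {RV P >-> R}.
Hypothesis indepW : independent_RVs W.

Let measurable_prodW (K : nat) (Q : pred 'I_K) (f : nat -> R -> R) :
  (forall k, measurable_fun setT (f k)) ->
  measurable_fun setT (fun w => \prod_(k < K | Q k) f k (W k w)).
Proof.
move=> mf; under eq_fun do rewrite big_mkcond/=.
apply: measurable_prod => k _; case: (Q k) => //.
by apply: measurableT_comp => //; exact: mf.
Qed.

Let expectation_prod_indic (K : nat) (A : nat -> set R) :
  (forall k, measurable (A k)) ->
  (\int[P]_w (\prod_(k < K) \1_(A k) (W k w))%:E =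
   \prod_(k < K) \int[P]_w (\1_(A k) (W k w))%:E)%E.
Proof.
move=> mA.
have mWA k : measurable (W k @^-1` A k).
  by rewrite -[X in measurable X]setTI; exact: measurable_funP.
transitivity
    (\int[P]_w (\1_(\bigcap_(i in [set` iota 0 K]) (W i @^-1` A i)) w)%:E)%E.
  apply: eq_integral => w _; congr EFin; rewrite indicE.
  have [wA|wA] := pselect (forall k : 'I_K, A k (W k w)).
    rewrite mem_set => [|i /=]; last first.
      by rewrite mem_iota add0n => /= iK; exact: (wA (Ordinal iK)).
    by rewrite big1// => k _; rewrite indicE mem_set.
  rewrite memNset => [|h]; last first.
    by apply: wA => k; apply: h; rewrite /= mem_iota add0n/=.
  have /existsNP[k nAk] := wA.
  by rewrite (bigD1 k)//= indicE memNset// mul0r.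
rewrite integral_indic//; last first.
  by apply: fin_bigcap_measurable => // k _; exact: mWA.
rewrite setIT; etransitivity; first exact: (indepW (iota_uniq 0 K) mA).
rewrite -[in LHS](subn0 K) -/(index_iota 0 K) big_mkord.
apply: eq_bigr => k _.
transitivity (\int[P]_w (\1_(W k @^-1` A k) w)%:E)%E => //.
by rewrite integral_indic// setIT.
Qed.

(** Factors are upgraded from indicators to bounded functions one at a time:
    from index [j] on they are still indicators.  Given the other factors,
    the [j]-th expectation is an integral against a multiple of the law of
    [W j], by change of variables. *)
Let expectation_prod_step (j K : nat) (f : nat -> R -> R) :
  (forall k, measurable_fun setT (f k)) -> (forall k y, 0 <= f k y <= 1) ->
  (forall k, (j <= k)%N -> exists2 A, measurable A & f k = \1_A) ->
  (\int[P]_w (\prod_(k < K) f k (W k w))%:E =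
   \prod_(k < K) \int[P]_w (f k (W k w))%:E)%E.
Proof.
elim: j f => [|j IH] f mf f01 fA.
  have /choice[A AP] : forall k, exists A, measurable A /\ f k = \1_A.
    by move=> k; have [//|A mA fE] := fA k; exists A.
  have -> : f = (fun k => \1_(A k)) by apply/funext => k; have [] := AP k.
  by apply: expectation_prod_indic => k; have [] := AP k.
have [jK|Kj] := ltnP j K; last first.
  pose f' k := if (k < K)%N then f k else \1_setT.
  have ff' (k : 'I_K) : f k = f' k by rewrite /f' ltn_ord.
  under eq_integral do under eq_bigr do rewrite ff'.
  under [RHS]eq_bigr do rewrite ff'.
  rewrite IH// /f' => k; first by case: ifP.
  - by case: ifP => // _ y; rewrite indicT ler01 lexx.
  - move=> jk; rewrite ltnNge (leq_trans Kj jk)/=.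
    by exists setT.
pose o : 'I_K := Ordinal jK.
pose G w := \prod_(k < K | k != o) f k (W k w).
pose c := (\prod_(k < K | k != o) \int[P]_w (f k (W k w))%:E)%E.
have f0 k y : 0 <= f k y by have /andP[] := f01 k y.
have cE : c \is a fin_num /\ (0 <= c)%E.
  rewrite /c; elim/big_ind : _ => //.
  - by move=> x y [xf x0] [yf y0]; rewrite fin_numM ?mule_ge0.
  - move=> k _; have i0 : (0 <= \int[P]_w (f k (W k w))%:E)%E.
      by apply: integral_ge0 => w _; rewrite lee_fin.
    split=> //; rewrite ge0_fin_numE//.
    apply: (@le_lt_trans _ _ (\int[P]_w (cst 1%E w))%E).
      apply: ge0_le_integral => //.
      - by move=> w _; rewrite lee_fin.
      - by apply/measurable_EFinP; exact: measurableT_comp.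
      - by move=> w _; rewrite lee_fin; have /andP[] := f01 k (W k w).
    by rewrite integral_cst// mul1e (le_lt_trans (probability_le1 P measurableT))// ltry.
have [cf c0] := cE.
have [r r0 crE] : exists2 r, 0 <= r & c = r%:E.
  by exists (fine c); rewrite ?fine_ge0 ?fineK.
have mG : measurable_fun setT G by exact: measurable_prodW.
have main : (\int[P]_w (G w * f j (W j w))%:E =
             c * \int[P]_w (f j (W j w))%:E)%E.
  have massE A : mscale (NngNum r0) (distribution P (W j)) A =
      (r%:E * P (W j @^-1` A))%E by [].
  rewrite -(@integral_image_density _ _ _ _ _ P
    (mscale (NngNum r0) (distribution P (W j))) (W j) G) //; last first.
  - move=> A mA; transitivity (r%:E * P (W j @^-1` A))%E; first exact: massE.
    rewrite -crE.
    pose fA' k := if k == j then \1_A else f k.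
    have fA'E (k : 'I_K) : k != o -> fA' k = f k.
      by move=> ko; rewrite /fA' ifN//; apply: contra ko => /eqP kj; apply/eqP/val_inj.
    have fA'j : fA' o = \1_A by rewrite /fA' eqxx.
    transitivity (\int[P]_w (\prod_(k < K) fA' k (W k w))%:E)%E; last first.
      apply: eq_integral => w _; congr EFin; rewrite (bigD1 o)//= mulrC fA'j.
      by congr (_ * _); apply: eq_bigr => k ko; rewrite fA'E.
    rewrite IH; first 1 last.
    + by move=> k; rewrite /fA'; case: ifP => // _; exact: measurable_indic.
    + move=> k y; rewrite /fA'; case: ifP => // _; rewrite indicE.
      by case: (_ \in _); rewrite ?lexx ?ler01.
    + move=> k; rewrite leq_eqVlt => /orP[/eqP <-|jk]; first by exists A.
      by rewrite /fA' gtn_eqF//; exact: fA.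
    rewrite (bigD1 o)//= muleC fA'j; congr (_ * _)%E.
      transitivity (\int[P]_w (\1_(W j @^-1` A) w)%:E)%E => //.
      rewrite integral_indic// ?setIT//.
      by rewrite -[X in measurable X]setTI; exact: measurable_funP.
    by apply: eq_bigr => k ko; rewrite fA'E.
  - apply: (@le_lt_trans _ _ (r%:E * P setT)%E); first exact: lexx.
    apply: (@le_lt_trans _ _ (r%:E * 1)%E); last by rewrite mule1 ltry.
    by apply: lee_wpmul2l; rewrite ?lee_fin//; exact: probability_le1.
  - by move=> w; apply: prodr_ge0.
  rewrite ge0_integral_mscale//; last 2 first.
  - exact/measurable_EFinP.
  - by move=> y _; rewrite lee_fin.
  rewrite crE; congr (_ * _)%E; rewrite ge0_integral_distribution//.
    exact/measurable_EFinP.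
  by move=> y; rewrite lee_fin.
rewrite (bigD1 o)//= muleC -main.
by apply: eq_integral => w _; rewrite (bigD1 o)//= mulrC.
Qed.

Lemma expectation_prod (K : nat) (f : nat -> R -> R) :
  (forall k, measurable_fun setT (f k)) -> (forall k y, 0 <= f k y <= 1) ->
  (\int[P]_w (\prod_(k < K) f k (W k w))%:E =
   \prod_(k < K) \int[P]_w (f k (W k w))%:E)%E.
Proof.
move=> mf f01; pose f' k := if (k < K)%N then f k else \1_setT.
have ff' (k : 'I_K) : f k = f' k by rewrite /f' ltn_ord.
under eq_integral do under eq_bigr do rewrite ff'.
under [RHS]eq_bigr do rewrite ff'.
apply: (@expectation_prod_step K).
- by move=> k; rewrite /f'; case: ifP.
- by move=> k y; rewrite /f'; case: ifP => // _; rewrite indicT ler01 lexx.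
- by move=> k Kk; rewrite /f' ltnNge Kk/=; exists setT.
Qed.

End product_expectation.

(** * Occupancy as a chain of decreasing sets *)

Section chains.
Local Open Scope nat_scope.
Variables (R : realType) (I : finType) (b : {set I} -> {set I} -> R).

(** Total weight of the chains of sets that start at [D], make [K] weakly
    decreasing steps and end at the empty set, the step from [D] to [A] having weight [b A D]. *)
Fixpoint chain_sum (K : nat) (D : {set I}) : R :=
  if K is K'.+1 then (\sum_(A : {set I} | A \subset D) b A D * chain_sum K' A)%R
  else ((D == finset.set0) : nat)%:R%R.

(** For an allocation [j], the balls that lie at or beyond box [k]. *)
Definition level K (j : I -> 'I_K) (k : nat) : {set I} := [set i | k <= j i]%SET.

Let unshift K (j : {ffun I -> 'I_K.+2}) : {ffun I -> 'I_K.+1} :=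
  [ffun i => inord (j i).-1].
Let shift K (D : {set I}) (j : {ffun I -> 'I_K.+1}) : {ffun I -> 'I_K.+2} :=
  [ffun i => if i \in D then inord (j i).+1 else ord0].

Let val_shift K (D : {set I}) (j : {ffun I -> 'I_K.+1}) i :
  shift D j i = (if i \in D then (j i).+1 else 0) :> nat.
Proof.
rewrite ffunE; case: ifP => // _.
by rewrite inordK// ltnS ltn_ord.
Qed.

Let val_unshift K (j : {ffun I -> 'I_K.+2}) i : unshift j i = (j i).-1 :> nat.
Proof. by rewrite ffunE inordK//; have := ltn_ord (j i); case: (nat_of_ord _). Qed.

(** An allocation is the same as the decreasing chain of its levels.  The
    induction removes the first step of the chain; levels start at 1 so that
    the balls outside [D] can be parked in box 0, which makes the type of
    allocations independent of [D]. *)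
Lemma chain_sum_restricted K (D : {set I}) :
  (\sum_(j : {ffun I -> 'I_K.+1} | level j 1 == D)
     \prod_(k < K) b (level j k.+2) (level j k.+1) = chain_sum K D)%R.
Proof.
elim: K D => [|K IH] D /=.
  under eq_bigr do rewrite big_ord0.
  have lev0 (j : {ffun I -> 'I_1}) : level j 1 = finset.set0.
    by apply/setP => i; rewrite !inE; case: (j i) => -[].
  have [->|D0] := eqVneq D finset.set0.
    rewrite (eq_bigl xpredT) => [|j]; last by rewrite lev0 eqxx.
    by rewrite sumr_const card_ffun card_ord exp1n.
  by rewrite big_pred0// => j; rewrite lev0 eq_sym (negbTE D0).
rewrite (partition_big (fun j : {ffun I -> 'I_K.+2} => level j 2)
  (fun A => A \subset D)) /=; last first.
  move=> j /eqP <-; apply/fintype.subsetP => i; rewrite !inE; exact: ltnW.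
apply: eq_bigr => A AD; rewrite -IH big_distrr/=.
rewrite (reindex_onto (@shift K D) (@unshift K)) /=; last first.
  move=> j /andP[/eqP jD _]; apply/ffunP => i; apply/val_inj.
  rewrite /= val_shift val_unshift -jD inE.
  by case: (nat_of_ord (j i)).
apply: eq_big => [j|j].
  apply/idP/idP => [/andP[/andP[/eqP h1 /eqP h2] /eqP h3]|/eqP jA].
    apply/eqP; rewrite -h2; apply/setP => i; rewrite !inE val_shift.
    case: ifPn => // iD; move: h3 => /ffunP/(_ i)/(congr1 val)/=.
    by rewrite val_unshift val_shift (negbTE iD) /= => <-.
  have jD i : i \notin D -> j i = 0 :> nat.
    move=> iD; apply/eqP; rewrite -leqn0 leqNgt; apply: contra iD => ji.
    by apply: (fintype.subsetP AD); rewrite -jA inE.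
  apply/andP; split; [apply/andP; split|].
  - by apply/eqP/setP => i; rewrite inE val_shift; case: ifP.
  - apply/eqP; rewrite -jA; apply/setP => i; rewrite !inE val_shift.
    by case: ifPn => // /jD ->.
  - apply/eqP/ffunP => i; apply/val_inj => /=; rewrite val_unshift val_shift.
    by case: ifPn => // /jD ->.
move=> /andP[/andP[/eqP h1 /eqP h2] /eqP h3].
have jD i : i \notin D -> j i = 0 :> nat.
  move=> iD; move: h3 => /ffunP/(_ i)/(congr1 val)/=.
  by rewrite val_unshift val_shift (negbTE iD) /= => <-.
have levS k : level (shift D j) k.+2 = level j k.+1.
  apply/setP => i; rewrite !inE val_shift.
  by case: ifPn => // /jD ->.
rewrite big_ord_recl/= h1 h2; congr (_ * _)%R.
by apply: eq_bigr => k _; rewrite /bump/= !add1n !levS.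
Qed.

Lemma chain_sumE K :
  (\sum_(j : {ffun I -> 'I_K})
     \prod_(k < K) b (level j k.+1) (level j k) = chain_sum K [set: I]%SET)%R.
Proof.
case: K => [|K].
  under eq_bigr do rewrite big_ord0.
  rewrite sumr_const card_ffun card_ord /=.
  rewrite -cards_eq0 cardsT; case: #|I| => [|n]; first by rewrite expn0.
  by rewrite exp0n.
rewrite -chain_sum_restricted.
pose up (j : {ffun I -> 'I_K.+1}) : {ffun I -> 'I_K.+2} :=
  [ffun i => inord (j i).+1].
have val_up (j : {ffun I -> 'I_K.+1}) i : up j i = (j i).+1 :> nat.
  by rewrite ffunE inordK// ltnS ltn_ord.
rewrite (reindex_onto up (@unshift K)) /=; last first.
  move=> j /eqP /setP jT; apply/ffunP => i; apply/val_inj.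
  rewrite /= val_up val_unshift; have := jT i; rewrite !inE.
  by case: (nat_of_ord (j i)).
apply: eq_big => [j|j _].
  symmetry; apply/andP; split.
    by apply/eqP/setP => i; rewrite !inE val_up.
  by apply/eqP/ffunP => i; apply/val_inj; rewrite /= val_unshift val_up.
by apply: eq_bigr => k _; congr (b _ _); apply/setP => i; rewrite !inE val_up.
Qed.

End chains.

Lemma sum_lt (K M : nat) : (\sum_(k < K) (k < M : nat) = minn K M)%N.
Proof.
elim: K => [|K IH]; first by rewrite big_ord0 min0n.
rewrite big_ord_recr/= IH; lia.
Qed.

Lemma size_undup_bounded (s : seq nat) (K : nat) : {in s, forall m, m < K}%N ->
  (size (undup s) = \sum_(k < K) ((k : nat) \in s : nat))%N.
Proof.
move=> sK; rewrite -(big_mkord xpredT (fun k => (k \in s : nat))) /index_iota subn0.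
transitivity (count (mem s) (iota 0 K)).
  rewrite -size_filter; apply: perm_size; apply: uniq_perm.
  - exact: undup_uniq.
  - by rewrite filter_uniq ?iota_uniq.
  - move=> m; rewrite mem_undup mem_filter /= mem_iota add0n /=.
    by case: (boolP (m \in s)) => //= /sK ->.
rewrite -sum1_count big_mkcond/=.
by apply: eq_bigr => k _; case: (k \in s).
Qed.

(** Box [k] is in the occupancy range iff level [k] is nonempty, and it is
    unoccupied iff levels [k] and [k + 1] agree. *)
Lemma empty_boxes_levels (I : finType) (K : nat) (j : I -> 'I_K) :
  (\max_(i : I) (j i).+1 - size (undup [seq (j i : nat) | i <- enum I]) =
   \sum_(k < K) ((level j k.+1 == level j k) && (level j k != finset.set0) : nat))%N.
Proof.
set M := (\max_(i : I) (j i).+1)%N.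
have MK : (M <= K)%N by apply/bigmax_leqP => i _; exact: ltn_ord.
have kM (k : 'I_K) : (k < M)%N = (level j k != finset.set0).
  apply/idP/idP.
    rewrite ltnNge => h; apply/set0Pn.
    case: (pickP (fun i => k <= j i)%N) => [i kj|no]; first by exists i; rewrite inE.
    case/negP: h; apply/bigmax_leqP => i _.
    by have := no i; rewrite /= ltnNge => ->.
  case/set0Pn => i; rewrite inE => kj.
  by apply: leq_trans (leq_bigmax i); rewrite ltnS.
have occ (k : 'I_K) : ((k : nat) \in [seq (j i : nat) | i <- enum I]) =
    (level j k.+1 != level j k).
  apply/mapP/idP.
    case=> i _ kj; apply/negP => /eqP /setP /(_ i).
    by rewrite !inE kj ltnn leqnn.
  move=> h; case: (pickP (fun i => j i == k :> nat)) => [i /eqP ji|no].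
    by exists i; rewrite ?mem_enum.
  case/negP: h; apply/eqP/setP => i; rewrite !inE ltn_neqAle eq_sym.
  by have := no i => /= ->.
rewrite -{1}(minn_idPr MK) -sum_lt.
rewrite (@size_undup_bounded _ K); last by move=> m /mapP[i _ ->].
apply/eqP; rewrite -(eqn_add2r (\sum_(k < K)
  ((k : nat) \in [seq (j i : nat) | i <- enum I] : nat))) subnK.
  rewrite -big_split/=; apply/eqP; apply: eq_bigr => k _.
  rewrite kM occ.
  have [e|ne] := eqVneq (level j k.+1) (level j k); first by rewrite addn0.
  have -> // : level j k != finset.set0.
  apply: contra ne => /eqP lk0; rewrite lk0 -finset.subset0 -lk0.
  by apply/fintype.subsetP => i; rewrite !inE; exact: ltnW.
apply: leq_sum => k _; rewrite occ kM.
case: (boolP (level j k != finset.set0)) => [_|]; first by case: (_ != _).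
rewrite negbK => /eqP lk0; rewrite lk0 leqn0 eqb0 negbK -finset.subset0 -lk0.
by apply/fintype.subsetP => i; rewrite !inE; exact: ltnW.
Qed.

(** * The allocation law and the generating function of the empty boxes *)

Section moments.
Context d0 (T0 : measurableType d0) (R : realType) (P0 : probability T0 R).
Variable W0 : {RV P0 >-> R}.
Hypothesis hW0 : forall w, 0 < W0 w < 1.

Definition moment (r c : nat) : R :=
  fine (\int[P0]_w (W0 w ^+ r * (1 - W0 w) ^+ c)%:E).

Let beta01 (x : R) r c : 0 <= x <= 1 -> 0 <= x ^+ r * (1 - x) ^+ c <= 1.
Proof.
move=> /andP[x0 x1]; have y0 : 0 <= 1 - x by rewrite subr_ge0.
rewrite mulr_ge0 ?exprn_ge0//= mulr_ile1 ?exprn_ge0 ?exprn_ile1//.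
by rewrite gerBl.
Qed.

Let W01 w : 0 <= W0 w <= 1.
Proof. by have /andP[/ltW -> /ltW ->] := hW0 w. Qed.

Lemma measurable_beta (r c : nat) :
  measurable_fun [set: R] (fun x : R => x ^+ r * (1 - x) ^+ c).
Proof.
apply: measurable_funM; first exact: exprn_measurable.
by apply: measurable_funX; exact: measurable_funB.
Qed.

Let measurable_betaW (r c : nat) :
  measurable_fun setT (fun w => (W0 w ^+ r * (1 - W0 w) ^+ c)%:E).
Proof.
apply/measurable_EFinP.
by apply: (measurableT_comp (measurable_beta r c)).
Qed.

Lemma momentE r c :
  (moment r c)%:E = (\int[P0]_w (W0 w ^+ r * (1 - W0 w) ^+ c)%:E)%E.
Proof.
have i0 : (0 <= \int[P0]_w (W0 w ^+ r * (1 - W0 w) ^+ c)%:E)%E.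
  by apply: integral_ge0 => w _; rewrite lee_fin; have /andP[] := beta01 r c (W01 w).
rewrite /moment fineK// ge0_fin_numE//.
apply: (@le_lt_trans _ _ (\int[P0]_w (cst 1%E w))%E).
  apply: ge0_le_integral => //.
  - by move=> w _; rewrite lee_fin; have /andP[] := beta01 r c (W01 w).
  - by move=> w _; rewrite lee_fin; have /andP[] := beta01 r c (W01 w).
rewrite integral_cst//.
by rewrite mul1e (le_lt_trans (probability_le1 P0 measurableT))// ltry.
Qed.

Lemma moment_ge0 r c : 0 <= moment r c.
Proof.
rewrite -lee_fin momentE; apply: integral_ge0 => w _.
by rewrite lee_fin; have /andP[] := beta01 r c (W01 w).
Qed.

Lemma moment00 : moment 0 0 = 1.
Proof.
apply: EFin_inj; rewrite momentE.
under eq_integral do rewrite !expr0 mulr1.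
by rewrite integral_cst// mul1e; exact: probability_setT.
Qed.

(** Strictness, from W < 1 everywhere, is what makes the denominators
    1 - E W ^ r of the linear system for the transforms positive. *)
Lemma moment_lt1 r : (0 < r)%N -> moment r 0 < 1.
Proof.
move=> r0; rewrite lt_neqAle; apply/andP; split; last first.
  rewrite -lee_fin momentE.
  apply: (@le_trans _ _ (\int[P0]_w (cst 1%E w))%E).
    apply: ge0_le_integral => //.
    - by move=> w _; rewrite lee_fin; have /andP[] := beta01 r 0 (W01 w).
    - by move=> w _; rewrite lee_fin; have /andP[] := beta01 r 0 (W01 w).
  by rewrite integral_cst// mul1e; exact: probability_le1.
apply/eqP => m1.
have W1 w : W0 w ^+ r < 1.
  by have /andP[w0 w1] := hW0 w; rewrite exprn_ilt1 ?ltW// -lt0n.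
have m1W : measurable_fun setT (fun w => (1 - W0 w ^+ r)%:E).
  apply/measurable_EFinP; apply: measurable_funB => //.
  exact: measurable_funX.
have mW : measurable_fun setT (fun w => (W0 w ^+ r)%:E).
  by apply/measurable_EFinP; exact: measurable_funX.
have iW : (\int[P0]_w (W0 w ^+ r)%:E = 1)%E.
  rewrite -m1 momentE; apply: eq_integral => w _.
  by rewrite expr0 mulr1.
have i0 : (\int[P0]_w (1 - W0 w ^+ r)%:E = 0)%E.
  have : (\int[P0]_w ((W0 w ^+ r)%:E + (1 - W0 w ^+ r)%:E) = 1)%E.
    under eq_integral do rewrite -EFinD addrC subrK.
    by rewrite integral_cst// mul1e; exact: probability_setT.
  rewrite ge0_integralD//; first 1 last.
  - by move=> w _; rewrite lee_fin exprn_ge0//; have /andP[/ltW] := hW0 w.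
  - by move=> w _; rewrite lee_fin subr_ge0 ltW.
  rewrite iW -[X in _ = X]adde0.
  by case: (integral _ _ _) => //= y [] /addrI ->.
have : (\int[P0]_w `|(1 - W0 w ^+ r)%:E| = 0)%E.
  rewrite -[RHS]i0; apply: eq_integral => w _.
  by rewrite gee0_abs// lee_fin subr_ge0 ltW.
move/(ae_eq_integral_abs P0 measurableT m1W) => -[N [mN N0 sub]].
have NT : N = setT.
  apply/seteqP; split => // w _; apply: sub => /= /(_ Logic.I) [].
  by apply/eqP; rewrite subr_eq0 gt_eqF.
move: N0; rewrite NT => PT0.
have : 1%E = 0%E :> \bar R by rewrite -[RHS]PT0; exact/esym/probability_setT.
by move/eqP; rewrite onee_eq0.
Qed.

(** Pointwise this is the binomial expansion of (W + (1 - W)) ^ |D| = 1: the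
    transition probabilities of the chain of levels sum to one. *)
Lemma sum_moment (I : finType) (D : {set I}) :
  \sum_(A : {set I} | A \subset D) moment #|A| (#|D| - #|A|) = 1.
Proof.
apply: EFin_inj; rewrite -sumEFin; under eq_bigr do rewrite momentE.
rewrite -big_filter -ge0_integral_sum//; last first.
  by move=> A w _; rewrite lee_fin; have /andP[] := beta01 #|A| (#|D| - #|A|) (W01 w).
transitivity (\int[P0]_w (cst 1%E w))%E; last first.
  by rewrite integral_cst// mul1e; exact: probability_setT.
apply: eq_integral => w _; rewrite sumEFin big_filter; congr EFin.
set x := W0 w.
pose F (i : I) := if i \in D then x else 0.
pose G (i : I) := if i \in D then 1 - x else 1.
transitivity (\prod_i (F i + G i)); last first.
  by apply: big1 => i _; rewrite /F /G; case: ifP; rewrite ?add0r// addrC subrK.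
rewrite bigA_distr [RHS](bigID (fun A : {set I} => A \subset D))/= [X in _ = _ + X]big1.
  rewrite addr0; apply: eq_bigr => A AD.
  rewrite (bigID (mem A))/=; congr (_ * _).
    rewrite (eq_bigr (fun=> x)) ?prodr_const// => i iA.
    by rewrite iA /F (fintype.subsetP AD).
  rewrite (bigID (mem D))/= [X in _ * X]big1 ?mulr1.
    rewrite (eq_bigr (fun=> 1 - x)); last first.
      by move=> i /andP[/negbTE-> iD]; rewrite /G iD.
    rewrite (eq_bigl (mem (D :\: A))); last by move=> i; rewrite !inE.
    by rewrite prodr_const cardsD (finset.setIidPr AD).
  by move=> i /andP[/negbTE-> /negbTE iD]; rewrite /G iD.
move=> A /subsetPn[i iA iD].
by rewrite (bigD1 i)//= iA /F (negbTE iD) mul0r.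
Qed.

End moments.

Section sieve_law.
Context d0 (T0 : measurableType d0) (R : realType) (P0 : probability T0 R).
Variable W0 : {RV P0 >-> R}.
Hypothesis hW0 : forall w, 0 < W0 w < 1.
Context d (T : measurableType d) (P : probability T R).
Variable W : nat -> {RV P >-> R}.
Hypothesis hW : independent_copies W0 W.

(** The indicator makes the integrand bounded on the whole line; it changes
    nothing at the [W k], which almost surely take values in the open unit
    interval. *)
Let unit_beta (r c : nat) (x : R) : R :=
  \1_(`]0, 1[%classic : set R) x * (x ^+ r * (1 - x) ^+ c).

Let unit_betaE r c x : 0 < x < 1 -> unit_beta r c x = x ^+ r * (1 - x) ^+ c.
Proof.
by move=> x01; rewrite /unit_beta indicE mem_set ?mul1r//= in_itv.
Qed.

Let unit_beta01 r c x : 0 <= unit_beta r c x <= 1.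
Proof.
rewrite /unit_beta indicE; case: (boolP (x \in _)) => [|_]; last first.
  by rewrite mul0r lexx ler01.
rewrite inE/= in_itv/= => /andP[/ltW x0 /ltW x1].
have y0 : 0 <= 1 - x by rewrite subr_ge0.
rewrite mul1r mulr_ge0 ?exprn_ge0//= mulr_ile1 ?exprn_ge0 ?exprn_ile1//.
by rewrite gerBl.
Qed.

Let measurable_unit_beta r c : measurable_fun setT (unit_beta r c).
Proof.
apply: measurable_funM; first by apply: measurable_indic; exact: measurable_itv.
exact: measurable_beta.
Qed.

Let expectation_unit_beta k r c :
  (\int[P]_w (unit_beta r c (W k w))%:E = (moment W0 r c)%:E)%E.
Proof.
have mE : measurable_fun setT (fun x => (unit_beta r c x)%:E).
  by apply/measurable_EFinP.
have E0 x : (0 <= (unit_beta r c x)%:E)%E.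
  by rewrite lee_fin; have /andP[] := unit_beta01 r c x.
rewrite -(ge0_integral_distribution (W k) mE E0).
have -> : (\int[distribution P (W k)]_y (unit_beta r c y)%:E =
           \int[distribution P0 W0]_y (unit_beta r c y)%:E)%E.
  by apply: eq_measure_integral => A mA _; exact: hW.2.
rewrite (ge0_integral_distribution W0 mE E0) momentE//.
by apply: eq_integral => w _ /=; rewrite unit_betaE.
Qed.

Let W_ae k : {ae P, forall w, 0 < W k w < 1}.
Proof.
exists (W k @^-1` (~` `]0, 1[%classic)); split.
- rewrite -[X in measurable X]setTI.
  by apply: measurable_funP => //; apply: measurableC; exact: measurable_itv.
- have := hW.2 k (~` `]0, 1[%classic).
  rewrite /distribution /pushforward => ->.
    rewrite (_ : _ @^-1` _ = set0) ?measure0//.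
    by apply/seteqP; split => // w /=; rewrite in_itv/= hW0.
  by apply: measurableC; exact: measurable_itv.
- by move=> w /= h; rewrite in_itv.
Qed.

(** A ball in box [m] contributes a factor W_k for each box k before m, that is
    for each k with the ball in level k + 1, and one factor 1 - W_m. *)
Lemma box_prob_prod K n (j : 'I_n -> 'I_K) w :
  \prod_(i < n) box_prob W (j i) w =
  \prod_(k < K) (W k w ^+ #|level j k.+1| *
     (1 - W k w) ^+ (#|level j k| - #|level j k.+1|)).
Proof.
have boxE (m : 'I_K) : box_prob W m w =
    \prod_(k < K) ((if (k < m)%N then W k w else 1) *
                   (if k == m then 1 - W k w else 1)).
  rewrite big_split/= [X in _ * X](bigD1 m)//= eqxx.
  rewrite [X in _ * (_ * X)]big1 ?mulr1; last by move=> k /negbTE ->.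
  rewrite /box_prob; congr (_ * _).
  rewrite -big_mkcond/= (big_ord_widen_cond K xpredT (fun k => W k w))//.
  exact: ltnW.
under eq_bigr do rewrite boxE.
rewrite exchange_big/=; apply: eq_bigr => k _.
rewrite big_split/=; congr (_ * _).
  rewrite -big_mkcond/= -[RHS]prodr_const; apply: eq_bigl => i.
  by rewrite inE.
rewrite -big_mkcond/= prodr_const; congr (_ ^+ _).
have sub : level j k.+1 \subset level j k.
  by apply/fintype.subsetP => i; rewrite !inE; exact: ltnW.
rewrite -cardsDS//; apply: eq_card => i.
rewrite !inE -leqNgt -eqn_leq.
by rewrite unfold_in eq_sym.
Qed.

(** Averaging the conditional allocation law over the box probabilities:
    independence of the [W k] factorizes the expectation along the levels. *)
Lemma sieve_law n (X : 'I_n -> {RV P >-> nat}) K (j : 'I_n -> 'I_K) :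
  sieve_allocation W X ->
  P [set w | forall i, X i w = j i] =
  (\prod_(k < K) moment W0 #|level j k.+1|
     (#|level j k| - #|level j k.+1|))%:E.
Proof.
move=> hX.
(* The unconditional law is obtained by conditioning on the sure event. *)
have sT : sigma_generated [set: nat] (box_prob W) setT.
  by move=> M [[M0 MC _] _]; rewrite -(setD0 setT); exact: MC.
have := hX setT (fun i => j i : nat) sT; rewrite setTI => ->.
pose f (k : nat) := unit_beta #|level j k.+1| (#|level j k| - #|level j k.+1|).
transitivity (\int[P]_w (\prod_(k < K) f k (W k w))%:E)%E; last first.
  rewrite (expectation_prod hW.1); first 1 last.
  - by move=> k; exact: measurable_unit_beta.
  - by move=> k y; exact: unit_beta01.
  by rewrite -prodEFin; apply: eq_bigr => k _; rewrite expectation_unit_beta.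
apply: ae_eq_integral => //.
- apply/measurable_EFinP; under eq_fun do rewrite box_prob_prod.
  apply: measurable_prod => k _.
  by apply: (measurableT_comp (measurable_beta _ _)).
- apply/measurable_EFinP; apply: measurable_prod => k _.
  by apply: (measurableT_comp (measurable_unit_beta _ _)).
- have := @ae_foralln _ _ _ _ _ W_ae.
  apply: filterS => w hw _; congr EFin; rewrite box_prob_prod.
  by apply: eq_bigr => k _; rewrite /f unit_betaE.
Qed.

(** A transition probability of the chain of levels, times [x] for each
    visited box that is empty inside the occupancy range. *)
Definition chain_weight (x : R) (I : finType) (A D : {set I}) : R :=
  moment W0 #|A| (#|D| - #|A|) *
  (if (A == D) && (D != finset.set0) then x else 1).

Let num_gaps n K (j : {ffun 'I_n -> 'I_K}) : nat := (\sum_(k < K)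
  ((level j k.+1 == level j k) && (level j k != finset.set0) : nat))%N.

Let alloc_event n (X : 'I_n -> {RV P >-> nat}) K (j : {ffun 'I_n -> 'I_K}) :=
  [set w | forall i, X i w = j i].

Let measurable_alloc_event n (X : 'I_n -> {RV P >-> nat}) K
  (j : {ffun 'I_n -> 'I_K}) : measurable (alloc_event X j).
Proof.
have -> : alloc_event X j = \bigcap_(i in [set: 'I_n]) (X i @^-1` [set (j i : nat)]).
  by apply/seteqP; split => [w h i _|w h i]; [exact: h|exact: h].
apply: fin_bigcap_measurable => // i _.
by rewrite -[X in measurable X]setTI; apply: measurable_funP.
Qed.

Let truncated n (X : 'I_n -> {RV P >-> nat}) K (x : R) (w : T) : R :=
  x ^+ empty_boxes X w * \1_[set w | forall i, (X i w < K)%N] w.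

Let truncatedE n (X : 'I_n -> {RV P >-> nat}) K (x : R) (w : T) :
  truncated X K x w =
  \sum_(j : {ffun 'I_n -> 'I_K}) x ^+ num_gaps j * \1_(alloc_event X j) w.
Proof.
rewrite /truncated; have [wK|wK] := pselect (forall i, (X i w < K)%N); last first.
  rewrite indicE memNset// mulr0 big1// => j _.
  by rewrite indicE memNset ?mulr0// => h; apply: wK => i; rewrite h.
pose j0 : {ffun 'I_n -> 'I_K} := [ffun i => Ordinal (wK i)].
have jX i : X i w = j0 i by rewrite ffunE.
rewrite (bigD1 j0)//= [X in _ = _ + X]big1 => [|j jj0]; last first.
  rewrite indicE memNset ?mulr0// => h; move/eqP: jj0; apply.
  by apply/ffunP => i; apply/val_inj; rewrite /= -h jX.
rewrite addr0 !indicE !mem_set//; congr (_ ^+ _ * _).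
rewrite /num_gaps -empty_boxes_levels /empty_boxes /last_occupied_box.
rewrite /occupied_boxes; congr (_ - _)%N.
  by apply: eq_bigr => i _; rewrite jX.
by congr (size (undup _)); apply: eq_map => i; rewrite jX.
Qed.

Let measurable_truncated n (X : 'I_n -> {RV P >-> nat}) K (x : R) :
  measurable_fun setT (truncated X K x).
Proof.
rewrite (funext (truncatedE X K x)).
by apply: measurable_sum => j; exact: measurable_funM.
Qed.

Let expectation_truncated n (X : 'I_n -> {RV P >-> nat}) K (x : R) : 0 <= x ->
  sieve_allocation W X ->
  (\int[P]_w (truncated X K x w)%:E =
   (chain_sum (@chain_weight x 'I_n) K [set: 'I_n]%SET)%:E)%E.
Proof.
move=> x0 hX; rewrite -chain_sumE.
under eq_integral do rewrite truncatedE -sumEFin.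
have mxE (j : {ffun 'I_n -> 'I_K}) :
    measurable_fun setT (fun w => (x ^+ num_gaps j * \1_(alloc_event X j) w)%:E).
  by apply/measurable_EFinP; apply: measurable_funM => //; exact: measurable_indic.
rewrite ge0_integral_sum//; last first.
  by move=> j w _; rewrite lee_fin mulr_ge0 ?exprn_ge0.
rewrite -sumEFin; apply: eq_bigr => j _.
under eq_integral do rewrite EFinM.
rewrite ge0_integralZl//; last 2 first.
- by apply/measurable_EFinP; exact: measurable_indic.
- by rewrite lee_fin exprn_ge0.
rewrite integral_indic// setIT.
have PE : P (alloc_event X j) = _ := sieve_law (fun i => j i) hX.
apply: etrans (congr1 (fun e => (x ^+ num_gaps j)%:E * e)%E PE) _.
rewrite -EFinM; congr EFin.
rewrite /chain_weight big_split/= mulrC; congr (_ * _).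
rewrite /num_gaps; elim/big_rec2 : _ => [|k u v _ uv]; first by rewrite expr0.
by rewrite exprD uv; case: (_ && _); rewrite ?expr1 ?expr0.
Qed.

(** Restricting to allocations into the first [K] boxes leaves a finite sum over
    allocations, hence over chains; monotone convergence removes the
    restriction. *)
Lemma pgf_empty_boxes n (X : 'I_n -> {RV P >-> nat}) (x : R) : 0 <= x ->
  sieve_allocation W X ->
  (chain_sum (@chain_weight x 'I_n) K [set: 'I_n]%SET)%:E @[K --> \oo] -->
  (\int[P]_w (x ^+ empty_boxes X w)%:E)%E.
Proof.
move=> x0 hX; rewrite -(funext (fun K => expectation_truncated K x0 hX)).
have tr0 K w : 0 <= truncated X K x w by rewrite mulr_ge0 ?exprn_ge0.
have -> : (\int[P]_w (x ^+ empty_boxes X w)%:E =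
    \int[P]_w limn (fun K => (truncated X K x w)%:E))%E.
  apply: eq_integral => w _; apply/esym/cvg_lim => //.
  apply: (@cvg_near_cst _ _ _ _ _ _).
  exists (\max_(i < n) (X i w).+1)%N => // K /= mK.
  rewrite /truncated indicE mem_set ?mulr1// => i.
  by apply: leq_trans mK; exact: (leq_bigmax i).
apply: cvg_monotone_convergence => //.
- by move=> K; apply/measurable_EFinP; exact: measurable_truncated.
- by move=> K w _; rewrite lee_fin.
- move=> w _ K K' KK'; rewrite lee_fin ler_wpM2l ?exprn_ge0// !indicE.
  have [wK|wK] := pselect (forall i, (X i w < K)%N).
    by rewrite !mem_set// => i; exact: leq_trans (wK i) KK'.
  by rewrite memNset.
Qed.

End sieve_law.

(** * The number of empty boxes is a Poisson mixture in distribution *)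

Section laplace_of_chain_sum.
Context d0 (T0 : measurableType d0) (R : realType) (P0 : probability T0 R).
Variable W0 : {RV P0 >-> R}.
Hypothesis hW0 : forall w, 0 < W0 w < 1.
Variable I : finType.
Implicit Types (A D : {set I}) (x s : R).

Let Z x K D : R := chain_sum (chain_weight W0 x (I := I)) K D.

Let weight_ge0 x A D : 0 <= x -> 0 <= chain_weight W0 x A D.
Proof.
by move=> x0; rewrite /chain_weight mulr_ge0 ?moment_ge0//; case: ifP.
Qed.

Let Z_ge0 x K D : 0 <= x -> 0 <= Z x K D.
Proof.
move=> x0; rewrite /Z; elim: K D => [|K IH] D /=; first by rewrite ler0n.
by apply: sumr_ge0 => A _; rewrite mulr_ge0 ?weight_ge0.
Qed.

Let Z_le1 x K D : 0 <= x <= 1 -> Z x K D <= 1.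
Proof.
move=> /andP[x0 x1]; rewrite /Z; elim: K D => [|K IH] D /=.
  by rewrite lern1 leq_b1.
rewrite -(sum_moment hW0 D); apply: ler_sum => A _.
rewrite -[leRHS]mulr1 ler_pM ?weight_ge0 ?Z_ge0// /chain_weight.
by case: ifP => _; rewrite ?mulr1// ler_piMr// moment_ge0.
Qed.

Let Z_set0 x K : Z x K finset.set0 = 1.
Proof.
rewrite /Z; elim: K => [|K IH] /=; first by rewrite eqxx.
rewrite (big_pred1 finset.set0) => [|A]; last by rewrite finset.subset0.
by rewrite IH /chain_weight eqxx andbF !mulr1 cards0 moment00.
Qed.

Let Z_nondecreasing x D : 0 <= x -> {homo (fun K => Z x K D) : K K' / (K <= K')%N >-> K <= K'}.
Proof.
move=> x0; apply/nondecreasing_seqP => K; elim: K D => [|K IH] D.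
  have [->|D0] := eqVneq D finset.set0; first by rewrite !Z_set0.
  have -> : Z x 0 D = 0 by rewrite /Z /= (negbTE D0).
  exact: Z_ge0.
by rewrite /Z /=; apply: ler_sum => A _; rewrite ler_wpM2l ?weight_ge0 ?IH.
Qed.

Definition chain_limit x D : R := limn (fun K => Z x K D).

Lemma cvg_chain_limit x D : 0 <= x <= 1 ->
  Z x K D @[K --> \oo] --> chain_limit x D.
Proof.
move=> x01; have /andP[x0 _] := x01; apply: nondecreasing_is_cvgn.
  exact: Z_nondecreasing.
by exists 1 => _ [K _ <-]; exact: Z_le1.
Qed.

Let chain_limit_set0 x : chain_limit x finset.set0 = 1.
Proof. by rewrite /chain_limit (funext (Z_set0 x)) lim_cst. Qed.

Let chain_limitE x D : 0 <= x <= 1 ->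
  chain_limit x D =
  \sum_(A : {set I} | A \subset D) chain_weight W0 x A D * chain_limit x A.
Proof.
move=> x01.
have c1 : Z x K.+1 D @[K --> \oo] --> chain_limit x D.
  by have := @cvg_chain_limit x D x01; rewrite -(cvg_shiftS (fun K => Z x K D)).
apply: (cvg_unique _ c1); first exact: norm_hausdorff.
apply: cvg_big => [|A AD]; first exact: add_continuous.
by apply: cvgMr; exact: cvg_chain_limit.
Qed.

(** In the one-step equation for [chain_limit] the term [A = D] has weight
    (1 - s) * w; moving it to the left gives the coefficient p + s * w. *)
Let chain_limit_solve s D : 0 <= s <= 1 -> D != finset.set0 ->
  chain_limit (1 - s) D =
  ((1 - moment W0 #|D| 0) + s * moment W0 #|D| 0)^-1 *
  \sum_(A : {set I} | A \proper D)
     moment W0 #|A| (#|D| - #|A|) * chain_limit (1 - s) A.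
Proof.
move=> /andP[s0 s1] D0.
have x01 : 0 <= 1 - s <= 1 by rewrite subr_ge0 s1 gerBl.
have m1 : moment W0 #|D| 0 < 1 by rewrite moment_lt1// card_gt0.
have m0 := moment_ge0 hW0 #|D| 0.
have den : 0 < (1 - moment W0 #|D| 0) + s * moment W0 #|D| 0.
  by rewrite ltr_pwDl ?subr_gt0// mulr_ge0.
apply: (canRL (mulKf (lt0r_neq0 den))).
have wD : chain_weight W0 (1 - s) D D = moment W0 #|D| 0 * (1 - s).
  by rewrite /chain_weight eqxx D0 subnn.
have := @chain_limitE (1 - s) D x01.
rewrite (bigD1 D)//= wD => eqD.
have -> : \sum_(A : {set I} | A \proper D)
     moment W0 #|A| (#|D| - #|A|) * chain_limit (1 - s) A =
  \sum_(A : {set I} | (A \subset D) && (A != D))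
     chain_weight W0 (1 - s) A D * chain_limit (1 - s) A.
  apply: eq_big => [A|A AD]; first by rewrite finset.properEneq andbC.
  rewrite /chain_weight (_ : (A == D) = false) ?mulr1//.
  by move: AD; rewrite finset.properEneq => /andP[/negbTE].
by rewrite mulrDl mulrBl mul1r {1}eqD; ring.
Qed.

(** Strong induction on the cardinal, the recursive formula being built from
    operations that preserve Laplace transforms. *)
Lemma laplace_mixture_chain_limit D :
  laplace_mixture (fun s => chain_limit (1 - s) D).
Proof.
have [n] := ubnP #|D|; elim: n D => // n IH D Dn.
have [->|D0] := eqVneq D finset.set0.
  apply: (@laplace_mixture_ext _ (fun s => (1 + s * 0)^-1)).
    by move=> s _; rewrite mulr0 addr0 invr1 chain_limit_set0.
  by apply: laplace_mixture_exponential; rewrite ?ltr01.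
apply: laplace_mixture_ext.
  by move=> s s01; apply/esym; exact: chain_limit_solve.
apply: laplace_mixtureM.
  apply: laplace_mixture_exponential; last exact: moment_ge0.
  by rewrite subr_gt0 moment_lt1// card_gt0.
apply: laplace_mixture_sum => A AD.
apply: laplace_mixtureZ; first exact: moment_ge0.
by apply: IH; apply: leq_trans (proper_card AD) _.
Qed.

End laplace_of_chain_sum.

Section laplace_empty_boxes.
Context d0 (T0 : measurableType d0) (R : realType) (P0 : probability T0 R).
Variable W0 : {RV P0 >-> R}.
Hypothesis hW0 : forall w, 0 < W0 w < 1.
Context d (T : measurableType d) (P : probability T R).
Variable W : nat -> {RV P >-> R}.
Hypothesis hW : independent_copies W0 W.

Lemma laplace_mixture_empty_boxes n (X : 'I_n -> {RV P >-> nat}) :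
  sieve_allocation W X ->
  exists phi, [/\ laplace_mixture phi, phi 0 = 1 & forall s : R, 0 <= s <= 1 ->
    (\int[P]_w ((1 - s) ^+ empty_boxes X w)%:E = (phi s)%:E)%E].
Proof.
move=> hX; pose phi (s : R) := chain_limit W0 (1 - s) [set: 'I_n]%SET.
have phiE s : 0 <= s <= 1 ->
    (\int[P]_w ((1 - s) ^+ empty_boxes X w)%:E = (phi s)%:E)%E.
  move=> /andP[s0 s1].
  have x01 : 0 <= 1 - s <= 1 by rewrite subr_ge0 s1 gerBl.
  have /andP[x0 _] := x01.
  apply: (cvg_unique _ (pgf_empty_boxes hW0 hW x0 hX)) => //.
  by apply: cvg_EFin; [exact: nearW|exact: (cvg_chain_limit hW0 x01)].
exists phi; split => //; first exact: laplace_mixture_chain_limit.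
apply: EFin_inj; rewrite -phiE ?lexx ?ler01// subr0.
under eq_integral do rewrite expr1n.
by rewrite integral_cst// mul1e; exact: probability_setT.
Qed.

End laplace_empty_boxes.

(** * Limits in distribution of integer-valued variables *)

Lemma nneseries_single (R : realType) (k0 : nat) (F : nat -> \bar R) :
  (forall i, i != k0 -> F i = 0%E) -> (\sum_(0 <= k <oo) F k = F k0)%E.
Proof.
move=> F0; apply/cvg_lim => //; apply: cvg_near_cst.
exists k0.+1 => // n /= k0n; rewrite big_mkord (bigD1 (Ordinal k0n))//=.
by rewrite big1 ?adde0// => i ik0; rewrite F0.
Qed.

(** A tail of a power series with nonnegative coefficients of total mass at most
    one is at most [x ^+ n]: this controls the remainder in coefficient
    extraction without any calculus. *)
Lemma power_series_tail (R : realType) (a : nat -> R) (x : R) (n : nat) :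
  (forall i, 0 <= a i) -> (\sum_(0 <= i <oo) (a i)%:E <= 1)%E -> 0 <= x <= 1 ->
  (\sum_(0 <= i <oo) (x ^+ i * a i)%:E <= (\sum_(i < n) x ^+ i * a i + x ^+ n)%:E)%E.
Proof.
move=> a0 a1 /andP[x0 x1].
have xa0 i : (0 <= (x ^+ i * a i)%:E)%E by rewrite lee_fin mulr_ge0 ?exprn_ge0.
apply: lime_le; first by apply: is_cvg_nneseries.
exists n => // m /= nm.
rewrite sumEFin lee_fin (big_cat_nat (n := n))//= big_mkord lerD2l.
apply: (@le_trans _ _ (\sum_(n <= i < m) x ^+ n * a i)).
  apply: ler_sum_nat => i /andP[ni _].
  by rewrite ler_wpM2r// ler_wiXn2l.
rewrite -mulr_sumr ler_piMr ?exprn_ge0//.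
apply: (@le_trans _ _ (\sum_(0 <= i < m) a i)).
  by rewrite [leRHS](big_cat_nat (n := n))//= lerDr sumr_ge0.
rewrite -lee_fin -sumEFin; apply: le_trans a1.
by apply: nneseries_lim_ge => i _ _; rewrite lee_fin.
Qed.

(** If the coefficients agree below [k], subtracting the common part and
    dividing by [x ^+ k] bounds their difference at [k] by [x], which is
    arbitrarily small. *)
Lemma power_series_unique (R : realType) (a b : nat -> R) :
  (forall i, 0 <= a i) -> (forall i, 0 <= b i) ->
  (\sum_(0 <= i <oo) (a i)%:E <= 1)%E -> (\sum_(0 <= i <oo) (b i)%:E <= 1)%E ->
  (forall x : R, 0 < x < 1 -> (\sum_(0 <= i <oo) (x ^+ i * a i)%:E =
    \sum_(0 <= i <oo) (x ^+ i * b i)%:E)%E) ->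
  forall k, a k = b k.
Proof.
move=> a0 b0 a1 b1 ab.
have half (u v : nat -> R) k : (forall i, 0 <= u i) -> (forall i, 0 <= v i) ->
    (\sum_(0 <= i <oo) (v i)%:E <= 1)%E ->
    (forall x : R, 0 < x < 1 -> (\sum_(0 <= i <oo) (x ^+ i * u i)%:E =
      \sum_(0 <= i <oo) (x ^+ i * v i)%:E)%E) ->
    (forall i, (i < k)%N -> u i = v i) -> u k <= v k.
  move=> u0 v0 v1 uv eqk; apply/ler_addgt0Pr => e e0.
  (* The minimum keeps the point below 1 when [e] is large. *)
  pose x := Num.min e (1 / 2).
  have x0 : 0 < x by rewrite lt_min e0/= divr_gt0.
  have x1 : x < 1 by rewrite gt_min; apply/orP; right; lra.
  have xe : x <= e by rewrite ge_min lexx.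
  have xk : 0 < x ^+ k by rewrite exprn_gt0.
  have x01 : 0 < x < 1 by rewrite x0.
  have lo : \sum_(i < k.+1) x ^+ i * u i <= \sum_(i < k.+1) x ^+ i * v i + x ^+ k.+1.
    rewrite -lee_fin; apply: le_trans (power_series_tail k.+1 v0 v1 _); last first.
      by rewrite !ltW.
    rewrite -uv// -sumEFin -(big_mkord xpredT (fun i => (x ^+ i * u i)%:E)).
    apply: nneseries_lim_ge => i _ _.
    by rewrite lee_fin mulr_ge0// exprn_ge0// ltW.
  move: lo; rewrite !big_ord_recr/=.
  rewrite (eq_bigr (fun i : 'I_k => x ^+ i * v i)) => [|i _]; last by rewrite eqk.
  rewrite -addrA lerD2l exprSr -mulrDr ler_pM2l// => lo.
  by rewrite (le_trans lo)// lerD2l.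
move=> k; have [m] := ubnP k; elim: m k => // m IH k km.
have eqk i : (i < k)%N -> a i = b i.
  by move=> ik; apply: IH; exact: leq_trans ik _.
apply/eqP; rewrite eq_le; apply/andP; split; apply: half => //.
- by move=> x x01; rewrite ab.
- by move=> i ik; rewrite eqk.
Qed.

Section integer_valued_limit.
Context d (T : measurableType d) (R : realType) (P : probability T R).
Variable N : nat -> T -> nat.
Context d' (T' : measurableType d') (P' : probability T' R).
Variable L : {RV P' >-> R}.
Hypothesis cvgNL : cvg_in_distribution P (fun n w => (N n w)%:R) L.

Let cvg_test (f : R -> R) (M : R) : continuous f -> (forall y, `|f y| <= M) ->
  (\int[P]_w (f (N n w)%:R)%:E)%E @[n --> \oo] --> (\int[P']_w (f (L w))%:E)%E.
Proof.
by move=> cf fM; have := cvgNL cf; rewrite unlock; apply; exists M.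
Qed.

(** A nonnegative bounded continuous function that vanishes on the naturals has
    zero expectation along the sequence, hence also at the limit. *)
Let ae_eq0_of_test (f : R -> R) : continuous f -> (forall y, 0 <= f y <= 2) ->
  (forall k : nat, f k%:R = 0) -> {ae P', forall w, f (L w) = 0}.
Proof.
move=> cf f02 fk.
have mfL : measurable_fun setT (fun w => (f (L w))%:E).
  apply/measurable_EFinP; apply: measurableT_comp => //.
  exact: continuous_measurable_fun.
have f0 y : 0 <= f y by have /andP[] := f02 y.
have i0 : (\int[P']_w `|(f (L w))%:E| = 0)%E.
  under eq_integral do rewrite gee0_abs ?lee_fin//.
  have f2 y : `|f y| <= 2 by rewrite ger0_norm//; have /andP[] := f02 y.
  apply: (cvg_unique _ (cvg_test cf f2)) => //.
  rewrite (_ : (fun n => _) = cst 0%E); first exact: cvg_cst.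
  apply/funext => n; apply: integral0_eq => w _.
  by rewrite fk.
have := (ae_eq_integral_abs P' measurableT mfL).1 i0.
by apply: filterS => w /(_ Logic.I) [].
Qed.

(** Test functions that are positive, respectively, on the negative half-line
    and on the interval from [k] to [k + 1] exclude all values that are not
    naturals. *)
Lemma limit_integer_valued : {ae P', forall w, exists k : nat, L w = k%:R}.
Proof.
have neg : {ae P', forall w, 1 - expR (L w - `|L w|) = 0}.
  apply: (@ae_eq0_of_test (fun y : R => 1 - expR (y - `|y|))).
  - move=> y; apply: cvgB; first exact: cvg_cst.
    apply: continuous_comp; last exact: continuous_expR.
    by apply: cvgB; [exact: cvg_id|exact: norm_continuous].
  - move=> y; rewrite subr_ge0 -expR0 ler_expR subr_le0 ler_norm/=.
    by rewrite expR0 lerBlDr (@le_trans _ _ 2) ?lerDl ?expR_ge0// ler1n.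
  - by move=> k; rewrite ger0_norm// subrr expR0 subrr.
(* A tent with support the interval from [k] to [k + 1]; [t + `|t|] is twice
   its positive part. *)
pose t (k : nat) (y : R) := 1 - `|2 * (y - k%:R) - 1|.
have ct k : continuous (t k).
  move=> y; apply: cvgB; first exact: cvg_cst.
  apply: (@cvg_norm _ R^o).
  apply: cvgB; last exact: cvg_cst.
  by apply: cvgMr; apply: cvgB; [exact: cvg_id|exact: cvg_cst].
have gap k : {ae P', forall w, t k (L w) + `|t k (L w)| = 0}.
  apply: (@ae_eq0_of_test (fun y : R => t k y + `|t k y|)).
  - move=> y; apply: cvgD; first exact: ct.
    by apply: (@cvg_norm _ R^o); exact: ct.
  - move=> y; have t1 : t k y <= 1 by rewrite /t gerBl.
    by have [t0|t0] := ger0P (t k y); rewrite ?subrr ?lexx ?ler0n//=; lra.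
  - move=> m; have tm : t k m%:R <= 0.
      rewrite /t subr_le0 ler_normr.
      have [mk|km] := leqP m k.
        apply/orP; right; have : m%:R <= k%:R :> R by rewrite ler_nat.
        lra.
      apply/orP; left; have : k.+1%:R <= m%:R :> R by rewrite ler_nat.
      rewrite -natr1; lra.
    by rewrite ler0_norm// subrr.
have := ae_foralln gap; apply: filterS2 neg => w Lneg Lgap.
have L0 : 0 <= L w.
  move: Lneg => /eqP; rewrite subr_eq0 eq_sym -expR0 => /eqP/expR_inj/eqP.
  by rewrite subr_eq0 => /eqP ->.
exists (Num.truncn (L w)).
have /andP[lo hi] := truncn_itv L0.
have := Lgap (Num.truncn (L w)).
apply: contra_eq => ne.
have lt : (Num.truncn (L w))%:R < L w by rewrite lt_neqAle eq_sym ne.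
have t0 : 0 < t (Num.truncn (L w)) (L w).
  move: hi; rewrite -natr1 => hi.
  by rewrite /t subr_gt0 ltr_norml; apply/andP; split; lra.
by rewrite gtr0_norm// gt_eqF// addr_gt0.
Qed.

(** The test function extending [x ^+ k] to the line uses [`|y|] in order to be
    bounded. *)
Lemma pgf_limit (x : R) : 0 < x < 1 ->
  (\int[P]_w (x ^+ N n w)%:E)%E @[n --> \oo] -->
  (\sum_(0 <= k <oo) (x ^+ k * fine (P' (L @^-1` [set k%:R])))%:E)%E.
Proof.
move=> /andP[x0 x1]; pose f (y : R) := expR (`|y| * ln x).
have fk (k : nat) : f k%:R = x ^+ k.
  by rewrite /f ger0_norm// expRM_natl lnK.
have cf : continuous f.
  move=> y; apply: continuous_comp; last exact: continuous_expR.
  by apply: cvgMl; exact: norm_continuous.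
have f1 y : `|f y| <= 1.
  rewrite ger0_norm ?expR_ge0// -expR0 ler_expR mulr_ge0_le0//.
  by rewrite -ln1 ler_ln ?posrE// ltW.
have mLk (k : nat) : measurable (L @^-1` [set k%:R]).
  by rewrite -[X in measurable X]setTI; apply: measurable_funP.
rewrite (_ : (\sum_(0 <= k <oo) _)%E = (\int[P']_w (f (L w))%:E)%E).
  rewrite (_ : (fun n => _) = (fun n => (\int[P]_w (f (N n w)%:R)%:E)%E)).
    exact: cvg_test cf f1.
  by apply/funext => n; apply: eq_integral => w _; rewrite fk.
transitivity (\int[P']_w \sum_(0 <= k <oo) (x ^+ k * \1_(L @^-1` [set k%:R]) w)%:E)%E.
  rewrite integral_nneseries//; last 2 first.
  - by move=> k; apply/measurable_EFinP; exact: measurable_funM.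
  - by move=> k w _; rewrite lee_fin mulr_ge0// exprn_ge0// ltW.
  apply: eq_eseriesr => k _.
  under eq_integral do rewrite EFinM.
  rewrite ge0_integralZl//; last 2 first.
  - by apply/measurable_EFinP; exact: measurable_indic.
  - by rewrite lee_fin exprn_ge0// ltW.
  by rewrite integral_indic// setIT EFinM fineK// fin_num_measure.
apply: ae_eq_integral => //.
- apply: (@ge0_emeasurable_sum _ _ _ _ _ xpredT) => [k w _ _|k _].
    by rewrite lee_fin mulr_ge0// exprn_ge0// ltW.
  by apply/measurable_EFinP; exact: measurable_funM.
- apply/measurable_EFinP; apply: measurableT_comp => //.
  exact: continuous_measurable_fun.
apply: filterS limit_integer_valued => w [k Lk] _.
rewrite (@nneseries_single _ k) => [|i ik].
  by rewrite Lk fk indicE mem_set ?mulr1.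
rewrite indicE memNset ?mulr0//= Lk => /eqP.
by rewrite eqr_nat eq_sym (negbTE ik).
Qed.

End integer_valued_limit.

(** * A source of independent exponential variables *)

Definition cylinder (n : nat) (s : nat -> bool) : set (nat -> bool) :=
  [set t | forall k, (k < n)%N -> t k = s k].

Definition cylinders : set (set (nat -> bool)) :=
  [set A | A = set0 \/ exists n s, A = cylinder n s].

Notation coins := (g_sigma_algebraType cylinders).

Lemma cylinders_setI_closed : setI_closed cylinders.
Proof.
have le_case n s m t : (n <= m)%N -> cylinders (cylinder n s `&` cylinder m t).
  move=> nm; have [st|st] := pselect (forall k, (k < n)%N -> t k = s k).
    right; exists m, t; apply/seteqP; split => [w []//|w wt]; split => // k kn.
    by rewrite wt ?st// (leq_trans kn).
  left; rewrite -subset0 => w [ws wt]; apply: st => k kn.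
  by rewrite -ws// wt// (leq_trans kn).
move=> A B [->|[n [s ->]]]; first by rewrite set0I; left.
move=> [->|[m [t ->]]]; first by rewrite setI0; left.
have [nm|/ltnW mn] := leqP n m; first exact: le_case.
by rewrite setIC; exact: le_case.
Qed.

Lemma cylinder0 s : cylinder 0 s = setT.
Proof. by apply/seteqP; split. Qed.

Lemma measurable_cylinder n s : measurable (cylinder n s : set coins).
Proof. by apply: sub_sigma_algebra; right; exists n, s. Qed.

Lemma cylinderS n s : cylinder n.+1 s =
  [set t | t 0%N = s 0%N] `&` (fun t k => t k.+1) @^-1` cylinder n (fun k => s k.+1).
Proof.
apply/seteqP; split=> [t ts|t [t0 ts] [|k] kn//]; last exact: ts.
by split; [exact: ts|move=> k kn; exact: ts].
Qed.

Lemma measurable_fun_coins d (T : measurableType d) (f : T -> coins) :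
  (forall k b, measurable [set w | f w k = b]) -> measurable_fun setT f.
Proof.
move=> mf; apply: (@measurability _ _ T coins setT f cylinders erefl).
move=> _ [_ [->|[n [s ->]]] <-]; first by rewrite preimage_set0 setI0.
rewrite setTI; have -> : f @^-1` cylinder n s =
    \bigcap_(k in `I_n) [set w | f w k = s k].
  by apply/seteqP; split=> w /= h k kn; exact: h.
exact: fin_bigcap_measurable.
Qed.

Lemma measurable_coin k b : measurable ([set t | t k = b] : set coins).
Proof.
pose ext (u : {ffun 'I_k.+1 -> bool}) (i : nat) : bool := u (inord i).
have -> : [set t | t k = b] =
    \bigcup_(u in [set u : {ffun 'I_k.+1 -> bool} | u ord_max = b])
      cylinder k.+1 (ext u).
  apply/seteqP; split=> [t /= tk|t [u /= ub ut]].
    exists [ffun i : 'I_k.+1 => t i]; first by rewrite /= ffunE.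
    by move=> i ik; rewrite /ext ffunE inordK.
  rewrite (ut k (ltnSn k)) /ext -ub; congr (u _).
  by apply/val_inj; rewrite /= inordK.
apply: fin_bigcup_measurable => [|u _]; first exact: finite_finset.
exact: measurable_cylinder.
Qed.

(** Cylinders form a pi-system generating the sigma-algebra. *)
Lemma coins_measure_unique (R : realType) (m1 m2 : {measure set coins -> \bar R}) :
  (forall n s, m1 (cylinder n s) = m2 (cylinder n s)) ->
  (m1 setT < +oo)%E ->
  forall A, measurable A -> m1 A = m2 A.
Proof.
move=> m12 fm; pose s0 (k : nat) := false.
apply: (@measure_unique _ _ coins cylinders (fun=> setT)) => //.
- exact: cylinders_setI_closed.
- by move=> _; right; exists 0, s0; rewrite cylinder0.
- by rewrite bigcup_const.
- by move=> A [->|[n [s ->]]]; rewrite ?measure0.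
Qed.

Section binary_digits.
Variable R : realType.
Implicit Types (x : R) (s : nat -> bool).

Definition doubling x : R := if x < 1 / 2 then 2 * x else 2 * x - 1.

Fixpoint digit x (k : nat) : bool :=
  if k is k'.+1 then digit (doubling x) k' else 1 / 2 <= x.

Fixpoint dyadic (n : nat) s : R :=
  if n is n'.+1 then ((s 0%N)%:R + dyadic n' (fun k => s k.+1)) / 2 else 0.

Lemma dyadic_bounds n s : 0 <= dyadic n s <= 1 - (1 / 2) ^+ n.
Proof.
elim: n s => [|n IH] s /=; first by rewrite expr0 subrr lexx.
have /andP[] := IH (fun k => s k.+1); rewrite exprS.
move: (dyadic n _) ((1 / 2) ^+ n) => v h v0 v1.
by case: (s 0%N) => /=; apply/andP; split; lra.
Qed.

(** The points with prescribed first [n] binary digits form a dyadic interval of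
    length 2 ^ (- n); this is why the digits of a uniform point are fair
    coins. *)
Lemma digits_itv n s x : 0 <= x < 1 ->
  cylinder n s (digit x) <-> dyadic n s <= x < dyadic n s + (1 / 2) ^+ n.
Proof.
elim: n s x => [|n IH] s x x01; first by rewrite cylinder0 expr0 add0r.
have /andP[] := dyadic_bounds n (fun k => s k.+1).
move: x01 => /andP[x0 x1].
have t01 : 0 <= doubling x < 1.
  by rewrite /doubling; case: ltP => xh; apply/andP; split; lra.
rewrite cylinderS /= exprS; have := IH (fun k => s k.+1) (doubling x) t01.
move: (dyadic n _) ((1 / 2) ^+ n) => v h IHx v0 v1.
rewrite /setI/=; split.
  move=> [s0 /IHx]; rewrite /doubling -s0.
  by case: (ltP x (1 / 2)) => xh /= /andP[? ?]; apply/andP; split; lra.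
move=> /andP[lo hi].
have s0 : (1 / 2 <= x) = s 0%N.
  by case: (s 0%N) lo hi => /= lo hi; apply/idP; rewrite -?ltNge; lra.
split => //; apply/IHx; move: lo hi; rewrite /doubling -s0.
by case: (ltP x (1 / 2)) => xh /= lo hi; apply/andP; split; lra.
Qed.

Lemma measurable_doubling : measurable_fun setT doubling.
Proof.
apply: measurable_fun_ifT => //; first exact: measurable_fun_ltr.
by apply: measurable_funB => //; exact: measurable_funM.
Qed.

Lemma measurable_digit : measurable_fun setT (digit : R -> coins).
Proof.
apply: measurable_fun_coins => k; elim: k => [|k IH] b /=.
  have -> : [set w : R | (1 / 2 <= w) = b] =
      (if b then `[1 / 2, +oo[ else `]-oo, 1 / 2[)%classic.
    apply/seteqP; split=> w; case: b => /=; rewrite in_itv/= ?andbT => //.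
    - by move/negbT; rewrite ltNge.
    - by rewrite ltNge => /negbTE.
  by case: b; exact: measurable_itv.
rewrite -[X in measurable X]setTI.
exact: (measurable_doubling measurableT (IH b)).
Qed.

End binary_digits.

Section uniform_law.
Variable R : realType.

Lemma uniform_probE (A : set R) : measurable A ->
  uniform_prob (@ltr01 R) A = lebesgue_measure (A `&` `[0, 1]%classic).
Proof.
move=> mA; rewrite /uniform_prob integral_uniform_pdf.
transitivity (\int[lebesgue_measure]_(x in A `&` `[0%R, 1%R]) (cst 1%E x : \bar R))%E.
  apply: eq_integral => x; rewrite inE/= => -[_].
  by rewrite in_itv/= /uniform_pdf => ->; rewrite subr0 invr1.
by rewrite integral_cst ?mul1e//; apply: measurableI.
Qed.

Lemma uniform_lawP : exists nu : {measure set R -> \bar R},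
  forall A, measurable A -> nu A = lebesgue_measure (A `&` `[0, 1]%classic).
Proof.
have mid : measurable_fun (setT : set (measurableTypeR R)) (fun x => x : R).
  exact: measurable_id.
pose m : {measure set (measurableTypeR R) -> \bar R} :=
  uniform_distribution_uniform_prob__canonical__measure_function_Measure (@ltr01 R).
unshelve eexists; first exact: (pushforward m (fun x => x : R)).
by move=> A mA; rewrite -uniform_probE.
Qed.

Lemma uniform_law_setT (nu : {measure set R -> \bar R}) :
  (forall A, measurable A -> nu A = lebesgue_measure (A `&` `[0, 1]%classic)) ->
  nu setT = 1%E.
Proof.
move=> nuE; rewrite nuE// setTI lebesgue_measure_itv/= lte_fin ltr01.
by rewrite -EFinD subr0.
Qed.

Lemma uniform_law_co (nu : {measure set R -> \bar R}) (a b : R) :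
  (forall A, measurable A -> nu A = lebesgue_measure (A `&` `[0, 1]%classic)) ->
  0 <= a -> a < b -> b <= 1 -> nu `[a, b[%classic = (b - a)%:E.
Proof.
move=> nuE a0 ab b1; rewrite nuE; last exact: measurable_itv.
rewrite (_ : _ `&` _ = `[a, b[%classic).
  by rewrite lebesgue_measure_itv/= lte_fin ab -EFinD.
apply/seteqP; split=> [x []//|x]; rewrite /= !in_itv/= => /andP[ax xb].
by rewrite ax xb (le_trans a0 ax) (le_trans (ltW xb) b1).
Qed.

Lemma uniform_law_ray (nu : {measure set R -> \bar R}) (a : R) :
  (forall A, measurable A -> nu A = lebesgue_measure (A `&` `[0, 1]%classic)) ->
  0 <= a <= 1 -> nu `]-oo, a]%classic = a%:E.
Proof.
move=> nuE /andP[a0 a1]; rewrite nuE; last exact: measurable_itv.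
rewrite (_ : _ `&` _ = `[0, a]%classic).
  rewrite lebesgue_measure_itv/= lte_fin; case: ltP => [_|a0'].
    by rewrite -EFinD subr0.
  by congr EFin; apply/eqP; rewrite eq_le a0 a0'.
apply/seteqP; split=> x; rewrite /= !in_itv/=; first by move=> [-> /andP[->]].
by move=> /andP[-> xa]; rewrite xa (le_trans xa a1).
Qed.

Lemma uniform_law_restr (nu : {measure set R -> \bar R}) (D : set R) :
  (forall A, measurable A -> nu A = lebesgue_measure (A `&` `[0, 1]%classic)) ->
  measurable D -> nu D = nu (D `&` `[0, 1[%classic).
Proof.
move=> nuE mD.
have m01 : measurable (`[0, 1[%classic : set R) by exact: measurable_itv.
have null : nu (D `\` `[0, 1[%classic) = 0%E.
  apply/eqP; rewrite eq_le measure_ge0 andbT.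
  apply: (@le_trans _ _ (nu (~` `[0, 1[%classic))).
    apply: le_measure; rewrite ?inE; first exact: measurableD.
      exact: measurableC.
    by move=> x [].
  rewrite nuE; last exact: measurableC.
  rewrite (_ : _ `&` _ = [set 1]) ?lebesgue_measure_set1//.
  apply/seteqP; split=> x /=; rewrite !in_itv/=.
    move=> [/negP x01 /andP[x0 x1]]; move: x01; rewrite x0/= -leNgt => x1'.
    by apply/eqP; rewrite eq_le x1.
  by move=> ->; rewrite ler01 ltxx lexx.
apply: etrans (measureDI nu mD m01) _; rewrite -[RHS]add0e.
by congr (_ + _)%E; exact: null.
Qed.

End uniform_law.

Lemma restr_image_measureP d d' (T : measurableType d) (T' : measurableType d')
  (R : realType) (m : {measure set T -> \bar R}) (D : set T) (f : T -> T') :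
  measurable D -> measurable_fun setT f ->
  exists m' : {measure set T' -> \bar R}, forall A, m' A = m (f @^-1` A `&` D).
Proof.
by move=> mD mf; unshelve eexists; first exact: (pushforward (mrestr m mD) f).
Qed.

Lemma scaled_measureP d (T : measurableType d) (R : realType)
  (m : {measure set T -> \bar R}) (c : R) : 0 <= c ->
  exists m' : {measure set T -> \bar R}, forall A, m' A = (c%:E * m A)%E.
Proof. by move=> c0; exists (mscale (NngNum c0) m). Qed.

Section fair_coins.
Variable R : realType.

Let digit_law (nu : {measure set R -> \bar R}) (n : nat) (s : nat -> bool) :
  (forall A, measurable A -> nu A = lebesgue_measure (A `&` `[0, 1]%classic)) ->
  nu (@digit R @^-1` cylinder n s) = ((1 / 2 : R) ^+ n)%:E.
Proof.
move=> nuE; set D := _ @^-1` _.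
have mD : measurable D.
  rewrite -[X in measurable X]setTI.
  by apply: measurable_digit => //; exact: measurable_cylinder.
rewrite (uniform_law_restr nuE mD).
rewrite (_ : _ `&` _ = `[dyadic R n s, dyadic R n s + (1 / 2) ^+ n[%classic).
  have h0 : 0 < (1 / 2 : R) ^+ n by rewrite exprn_gt0// divr_gt0.
  have /andP[v0 v1] := dyadic_bounds R n s.
  rewrite (uniform_law_co nuE)//; first by congr EFin; ring.
  - by rewrite ltrDl.
  - lra.
have h0 : 0 < (1 / 2 : R) ^+ n by rewrite exprn_gt0// divr_gt0.
have /andP[v0 v1] := dyadic_bounds R n s.
apply/seteqP; split=> x; rewrite /D /setI /= !in_itv/=.
  by move=> [ds x01]; apply/(digits_itv n s x01).
move=> vx; have x01 : 0 <= x < 1.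
  by move: vx => /andP[? ?]; apply/andP; split; lra.
by split => //; apply/(digits_itv n s x01).
Qed.

Variables (nu : {measure set R -> \bar R}) (kappa : {measure set coins -> \bar R}).
Hypothesis nuE : forall A, measurable A ->
  nu A = lebesgue_measure (A `&` `[0, 1]%classic).
Hypothesis kappaE : forall A, kappa A = nu (@digit R @^-1` A).

Let kappa_cylinder n s : kappa (cylinder n s) = ((1 / 2 : R) ^+ n)%:E.
Proof. by rewrite kappaE digit_law. Qed.

Let kappaT : kappa setT = 1%E.
Proof.
by rewrite -(cylinder0 (fun=> false)); have := kappa_cylinder 0 (fun=> false).
Qed.

Let shift (t : coins) : coins := fun k => t k.+1.
Let ev (t : coins) : coins := fun k => t k.*2.
Let od (t : coins) : coins := fun k => t k.*2.+1.

Let measurable_shift : measurable_fun setT shift.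
Proof. by apply: measurable_fun_coins => k b; exact: measurable_coin. Qed.

Let measurable_ev : measurable_fun setT ev.
Proof. by apply: measurable_fun_coins => k b; exact: measurable_coin. Qed.

Let measurable_od : measurable_fun setT od.
Proof. by apply: measurable_fun_coins => k b; exact: measurable_coin. Qed.

(** The first coin is fair and independent of the shifted sequence, which has
    the same law as the original one. *)
Let first_coin b (A : set coins) : measurable A ->
  kappa (shift @^-1` A `&` [set t | t 0%N = b]) = ((1 / 2)%:E * kappa A)%E.
Proof.
move=> mA.
have [m1 m1E] := restr_image_measureP kappa (measurable_coin 0 b) measurable_shift.
have h0 : 0 <= 1 / 2 :> R by rewrite divr_ge0.
have [m2 m2E] := scaled_measureP kappa h0.
rewrite -m1E -m2E; apply: coins_measure_unique => // [n s|]; last first.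
  rewrite m1E preimage_setT setTI.
  apply: (@le_lt_trans _ _ (kappa setT)).
    by rewrite le_measure ?inE//; exact: measurable_coin.
  by rewrite kappaT ltry.
rewrite m1E m2E kappa_cylinder setIC.
(* Prepending [b] to [s] describes the event by one longer cylinder. *)
pose s' k := if k is k'.+1 then s k' else b.
by rewrite -(cylinderS n s') kappa_cylinder exprS EFinM.
Qed.

Let shift_invariant (A : set coins) : measurable A ->
  kappa (shift @^-1` A) = kappa A.
Proof.
move=> mA; have mSA : measurable (shift @^-1` A).
  by rewrite -[X in measurable X]setTI; exact: measurable_shift.
apply: etrans (measureDI kappa mSA (measurable_coin 0 true)) _.
transitivity ((1 / 2)%:E * kappa A + (1 / 2)%:E * kappa A)%E.
  congr (_ + _)%E; last exact: first_coin.
  rewrite -(first_coin false mA); congr (kappa _).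
  by apply/seteqP; split=> t [At t0]; split=> //; move: t0 => /=; case: (t 0%N).
rewrite -ge0_muleDl ?lee_fin ?divr_ge0// -EFinD.
by rewrite (_ : _ + _ = 1) ?mul1e//; lra.
Qed.

(** Removing the first coin exchanges the two subsequences, one of them losing
    a term; hence the induction on the total number of prescribed coins. *)
Let ev_od_cylinder n m s t :
  kappa (ev @^-1` cylinder n s `&` od @^-1` cylinder m t) =
  ((1 / 2 : R) ^+ (n + m))%:E.
Proof.
have mev n' s' : measurable (ev @^-1` cylinder n' s').
  rewrite -[X in measurable X]setTI; apply: measurable_ev => //.
  exact: measurable_cylinder.
have mod_ n' s' : measurable (od @^-1` cylinder n' s').
  rewrite -[X in measurable X]setTI; apply: measurable_od => //.
  exact: measurable_cylinder.
have stepE n' s' B : ev @^-1` cylinder n'.+1 s' `&` od @^-1` B =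
    shift @^-1` (ev @^-1` B `&` od @^-1` cylinder n' (fun k => s' k.+1)) `&`
    [set t | t 0%N = s' 0%N].
  rewrite cylinderS; apply/seteqP; split.
    by move=> w [[w0 wS] wB].
  by move=> w [[wB wS] w0].
have [N] := ubnP (n + m)%N; elim: N n m s t => // N IH [|n] m s t nmN; last first.
  rewrite stepE first_coin; last exact: measurableI.
  by rewrite IH ?[(m + n)%N]addnC// -EFinM -exprS.
rewrite cylinder0 preimage_setT setTI add0n.
case: m t nmN => [|m] t nmN; first by rewrite cylinder0 preimage_setT kappaT expr0.
have -> : od @^-1` cylinder m.+1 t = shift @^-1` (ev @^-1` cylinder m.+1 t) by [].
rewrite shift_invariant//.
have := stepE m t setT; rewrite preimage_setT setIT => ->.
rewrite preimage_setT setTI first_coin//.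
rewrite -[X in kappa X]setTI -(preimage_setT ev) -(cylinder0 t) IH//.
by rewrite add0n -EFinM -exprS.
Qed.

(** Both sides are measures in [A] and in [B]; they agree on cylinders, and
    uniqueness is used in one variable and then in the other. *)
Lemma ev_od_independent (A B : set coins) : measurable A -> measurable B ->
  kappa (ev @^-1` A `&` od @^-1` B) = (kappa A * kappa B)%E.
Proof.
have mev A' : measurable A' -> measurable (ev @^-1` A').
  by move=> mA'; rewrite -[X in measurable X]setTI; exact: measurable_ev.
have mod_ A' : measurable A' -> measurable (od @^-1` A').
  by move=> mA'; rewrite -[X in measurable X]setTI; exact: measurable_od.
have fin_restr (m1 : {measure set coins -> \bar R}) D (f : coins -> coins) :
    measurable D -> (forall A', m1 A' = kappa (f @^-1` A' `&` D)) -> (m1 setT < +oo)%E.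
  move=> mD ->; rewrite preimage_setT setTI; apply: (@le_lt_trans _ _ (kappa setT)).
    by rewrite le_measure ?inE.
  by rewrite kappaT ltry.
have step1 m t A' : measurable A' ->
    kappa (ev @^-1` A' `&` od @^-1` cylinder m t) =
    (((1 / 2) ^+ m)%:E * kappa A')%E.
  have mt : measurable (od @^-1` cylinder m t)
    by apply: mod_; exact: measurable_cylinder.
  have [m1 m1E] := restr_image_measureP kappa mt measurable_ev.
  have h0 : 0 <= (1 / 2 : R) ^+ m by rewrite exprn_ge0// divr_ge0.
  have [m2 m2E] := scaled_measureP kappa h0.
  rewrite -m1E -m2E; apply: coins_measure_unique; last exact: (fin_restr _ _ _ mt m1E).
  move=> n s; rewrite m1E m2E ev_od_cylinder kappa_cylinder -EFinM.
  by rewrite addnC exprD.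
move=> mA; have [m1 m1E] := restr_image_measureP kappa (mev _ mA) measurable_od.
have kA0 : 0 <= fine (kappa A) by rewrite fine_ge0.
have [m2 m2E] := scaled_measureP kappa kA0.
have kAE : (fine (kappa A))%:E = kappa A.
  rewrite fineK// ge0_fin_numE//; apply: (@le_lt_trans _ _ (kappa setT)).
    by rewrite le_measure ?inE.
  by rewrite kappaT ltry.
rewrite setIC -m1E -kAE -m2E; move: B.
apply: coins_measure_unique; last exact: (fin_restr _ _ _ (mev _ mA) m1E).
move=> n s; rewrite m1E m2E setIC step1// kappa_cylinder kAE.
by rewrite muleC.
Qed.

Let nondecreasing_dyadic (t : coins) :
  {homo (fun n => dyadic R n t) : n m / (n <= m)%N >-> n <= m}.
Proof.
apply/nondecreasing_seqP => n; elim: n t => [|n IH] t.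
  by have /andP[] := dyadic_bounds R 1 t.
rewrite /= ler_pM2r ?invr_gt0//; rewrite lerD2l; exact: IH.
Qed.

Definition binary_value (t : coins) : R := limn (fun n => dyadic R n t).

Let cvg_dyadic (t : coins) : dyadic R n t @[n --> \oo] --> binary_value t.
Proof.
apply: nondecreasing_is_cvgn; first exact: nondecreasing_dyadic.
exists 1 => _ [n _ <-]; have /andP[_ h] := dyadic_bounds R n t.
by rewrite (le_trans h)// gerBl exprn_ge0// divr_ge0.
Qed.

Let measurable_binary_value : measurable_fun setT binary_value.
Proof.
apply: (@measurable_fun_cvg _ _ _ _ (fun n (t : coins) => dyadic R n t));
  last first.
  by move=> t _; exact: cvg_dyadic.
elim=> [|n IH]; first exact: measurable_cst.
have -> : (fun t : coins => dyadic R n.+1 t) = (fun t : coins =>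
    (\1_[set t' : coins | t' 0%N = true] t + dyadic R n (shift t)) / 2).
  apply/funext => t /=; congr ((_ + _) / 2); rewrite indicE.
  by case t0 : (t 0%N); [rewrite mem_set|rewrite memNset//= t0].
apply: measurable_funM => //; apply: measurable_funD.
  by apply: measurable_indic; exact: measurable_coin.
exact: (measurableT_comp IH measurable_shift).
Qed.

Let binary_value01 (t : coins) : 0 <= binary_value t <= 1.
Proof.
apply/andP; split.
  apply: limr_ge; [exact: cvg_dyadic|apply: nearW => n].
  by have /andP[] := dyadic_bounds R n t.
apply: limr_le; [exact: cvg_dyadic|apply: nearW => n].
have /andP[_ h] := dyadic_bounds R n t.
by rewrite (le_trans h)// gerBl exprn_ge0// divr_ge0.
Qed.

Let binary_valueK (x : R) : 0 <= x < 1 -> binary_value (digit x) = x.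
Proof.
move=> x01; apply/cvg_lim => //.
have dx n : x - (1 / 2) ^+ n <= dyadic R n (digit x) <= x.
  have /andP[lo hi] := (digits_itv n (digit x) x01).1 (fun k _ => erefl).
  by rewrite lo lerBlDr ltW.
apply: (@squeeze_cvgr _ _ _ _ (fun n => x - (1 / 2) ^+ n) (cst x)).
- exact: nearW.
- rewrite -[X in _ --> X]subr0; apply: cvgB; first exact: cvg_cst.
  by apply: cvg_expr; rewrite ger0_norm ?divr_ge0//; lra.
- exact: cvg_cst.
Qed.

(** Inverse of the exponential distribution function at the number with the
    given binary digits. *)
Definition exponential_value (t : coins) : R := - ln (1 - binary_value t).

Let exponential_value_ge0 t : 0 <= exponential_value t.
Proof.
rewrite /exponential_value oppr_ge0 ln_le0// gerBl.
by have /andP[] := binary_value01 t.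
Qed.

Let measurable_exponential_value : measurable_fun setT exponential_value.
Proof.
apply: measurableT_comp => //; apply: measurableT_comp => //.
exact: measurable_funB.
Qed.

Let exponential_value_lt (y : R) :
  kappa (exponential_value @^-1` `]-oo, y[%classic) =
  exponential_prob 1 `]-oo, y[%classic.
Proof.
have mE : measurable (exponential_value @^-1` `]-oo, y[%classic).
  by rewrite -[X in measurable X]setTI; apply: measurable_exponential_value.
have [y0|y0] := leP y 0.
  rewrite (_ : _ @^-1` _ = set0) ?measure0.
    rewrite /exponential_prob integral0_eq// => x; rewrite /= in_itv/= => xy.
    by rewrite lt0_exponential_pdf// (lt_le_trans xy).
  rewrite -subset0 => t /=; rewrite in_itv/= => /lt_le_trans /(_ y0).
  by rewrite ltNge exponential_value_ge0.
have -> : exponential_prob 1 `]-oo, y[%classic = exponential_prob (1 : R) `[0, y]%classic.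
  rewrite /exponential_prob -integral_itv_bndo_bndc; last first.
    by apply/measurable_funTS/measurable_EFinP; exact: measurable_exponential_pdf.
  rewrite [LHS]integral_mkcond [RHS]integral_mkcond; apply: eq_integral => x _.
  rewrite !patchE; have [x0|x0] := ltP x 0.
    by rewrite lt0_exponential_pdf// !if_same.
  by congr (if _ then _ else _); rewrite !mem_setE !in_itv/= x0.
rewrite exponential_prob_itv0c// mulN1r kappaE.
have mD : measurable (@digit R @^-1` (exponential_value @^-1` `]-oo, y[%classic)).
  by rewrite -[X in measurable X]setTI; exact: measurable_digit.
have e1 : expR (- y) < 1 by rewrite -expR0 ltr_expR oppr_lt0.
rewrite (uniform_law_restr nuE mD).
rewrite (_ : _ `&` _ = `[0, 1 - expR (- y)[%classic).
  by rewrite (uniform_law_co nuE)// ?subr0// ?subr_gt0// gerBl expR_ge0.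
apply/seteqP; split=> x; rewrite /= !in_itv/=.
  move=> [+ x01]; rewrite /exponential_value binary_valueK//.
  move: x01 => /andP[-> x1] /=; rewrite ltrNl => ey.
  have x1' : 0 < 1 - x by rewrite subr_gt0.
  by rewrite ltrBrDl addrC -ltrBrDl -(lnK (x := 1 - x)) ?posrE// ltr_expR.
move=> /andP[x0 xe]; have x1 : x < 1.
  by rewrite (lt_le_trans xe)// gerBl expR_ge0.
have x1' : 0 < 1 - x by rewrite subr_gt0.
have x01 : 0 <= x < 1 by rewrite x0.
split=> //; rewrite /exponential_value binary_valueK// ltrNl.
by rewrite -ltr_expR lnK ?posrE// ltrBrDl addrC -ltrBrDl.
Qed.

Let exponential_value_law (A : set R) : measurable A ->
  kappa (exponential_value @^-1` A) = exponential_prob 1 A.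
Proof.
have [m1 m1E] := restr_image_measureP kappa measurableT measurable_exponential_value.
have [m2 m2E] := exponential_lawP (@ltr01 R).
rewrite -m2E -[X in kappa X]setIT -m1E; move: A.
have cover : \bigcup_k `]-oo, k%:R[%classic = [set: R].
  apply/seteqP; split=> // x _; exists (Num.truncn x).+1 => //=.
  by rewrite in_itv/= truncnS_gt.
apply: (measure_unique (@RGenInftyO.G R) (fun k : nat => `]-oo, k%:R[%classic)
  _ _ _ cover).
- exact: RGenInftyO.measurableE.
- move=> _ _ [x ->] [y ->]; exists (Num.min x y).
  by apply/seteqP; split=> z; rewrite /= !in_itv/= lt_min => /andP.
- by move=> k; exists k%:R.
- by move=> _ [x ->]; rewrite m1E setIT m2E; exact: exponential_value_lt.
- move=> k; rewrite m1E setIT; apply: (@le_lt_trans _ _ (kappa setT)).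
    rewrite le_measure ?inE// -[X in measurable X]setTI.
    exact: measurable_exponential_value.
  by rewrite kappaT ltry.
Qed.

(** Spending only the even coins on the exponential variable leaves the odd ones,
    a fresh copy of the whole sequence, from which the next variable can be
    drawn in the same way. *)
Lemma exponential_splitting :
  let e := exponential_value \o ev in
  [/\ measurable_fun setT e, measurable_fun setT od, forall t, 0 <= e t,
      forall A, measurable A -> kappa (e @^-1` A) = exponential_prob 1 A &
      forall A B, measurable A -> measurable B ->
        kappa (e @^-1` A `&` od @^-1` B) =
        (kappa (e @^-1` A) * kappa B)%E].
Proof.
have mA' (A : set R) : measurable A -> measurable (exponential_value @^-1` A).
  by move=> mA; rewrite -[X in measurable X]setTI; exact: measurable_exponential_value.
have lawE (A : set R) : measurable A ->
    kappa ((exponential_value \o ev) @^-1` A) = kappa (exponential_value @^-1` A).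
  move=> mA; have := ev_od_independent (mA' _ mA) measurableT.
  by rewrite preimage_setT setIT kappaT mule1.
split.
- exact: measurableT_comp measurable_exponential_value measurable_ev.
- exact: measurable_od.
- by move=> t; exact: exponential_value_ge0.
- by move=> A mA; rewrite lawE ?exponential_value_law.
- by move=> A B mA mB; rewrite lawE// -ev_od_independent//; exact: mA'.
Qed.

End fair_coins.

Lemma probabilityP d (T : measurableType d) (R : realType)
  (m : {measure set T -> \bar R}) : m setT = 1%E ->
  exists P : probability T R, m = P :> {measure set T -> \bar R}.
Proof.
move=> m1.
have [|m' mm'] := @finite_measureP _ _ _ m; first by rewrite m1 ltry.
have m'1 : m' setT = 1%E by rewrite -m1 mm'.
pose H1 := isSubProbability.Build _ _ _ (FiniteMeasure.sort m') (eq_ind_r (fun x => (x <= 1)%E) (lexx _) m'1).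
pose H2 := isProbability.Build _ _ _ (FiniteMeasure.sort m') m'1.
pose P := HB.pack_for (probability T R) (FiniteMeasure.sort m') H1 H2.
by exists P; rewrite mm'; exact: eq_measure.
Qed.

(** A single splitting step, to be iterated: [e] is read off the current state
    and [V] passes to an independent copy of it. *)
Lemma exponential_source (R : realType) :
  exists (d : measure_display) (T : measurableType d) (P : probability T R)
    (e : T -> R) (V : T -> T),
  [/\ measurable_fun setT e, measurable_fun setT V, forall w, 0 <= e w,
      forall A, measurable A -> P (e @^-1` A) = exponential_prob 1 A &
      forall A B, measurable A -> measurable B ->
        P (e @^-1` A `&` V @^-1` B) = (P (e @^-1` A) * P B)%E].
Proof.
have [nu nuE] := uniform_lawP R.
have [kappa kE] := restr_image_measureP nu measurableT (@measurable_digit R).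
have kappaE A : kappa A = nu (@digit R @^-1` A) by rewrite kE setIT.
have kT : kappa setT = 1%E by rewrite kappaE preimage_setT (uniform_law_setT nuE).
have [P kP] := probabilityP kT.
have := exponential_splitting nuE kappaE; rewrite {}kP => h.
by exists _, coins, P, (exponential_value R \o (fun t k => t k.*2)),
  (fun t k => t k.*2.+1).
Qed.

(** * Erlang distribution functions *)

Section erlang.
Variable R : realType.
Implicit Types s t : R.

(** Distribution function at a nonnegative time of a sum of [k] independent
    standard exponential variables: the probability that a Poisson variable of
    mean [t] is at least [k]. *)
Definition erlang (k : nat) t : R :=
  1 - expR (- t) * \sum_(j < k) exp_coeff t j.

Let is_derive_exp_coeff (y : R) j :
  is_derive y 1 (fun y => exp_coeff y j.+1) (exp_coeff y j).
Proof.
have d1 : is_derive y (1 : R) (fun y : R => y ^+ j.+1) (j.+1%:R * y ^+ j).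
  apply: DeriveDef; first exact: exprn_derivable.
  by rewrite exp_derive /GRing.scale/= mulr1.
have d2 : is_derive y (1 : R) (fun y : R => (j.+1)`!%:R^-1 * y ^+ j.+1)
    ((j.+1)`!%:R^-1 * (j.+1%:R * y ^+ j)).
  exact: (is_deriveZ (j.+1)`!%:R^-1 d1).
rewrite (_ : (fun y => _) = (fun y => (j.+1)`!%:R^-1 * y ^+ j.+1)); last first.
  by apply/funext => u; rewrite /exp_coeff /= mulrC.
apply: (is_derive_eq d2).
have f0 : (j`!)%:R != 0 :> R by rewrite pnatr_eq0 -lt0n fact_gt0.
have j0 : (j.+1)%:R != 0 :> R by rewrite pnatr_eq0.
by rewrite /exp_coeff /= factS natrM; field; rewrite f0 nat1r j0.
Qed.

Let is_derive_opp_shift t s : is_derive s (1 : R) (fun s : R => t - s) (- 1).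
Proof.
apply: (is_derive_eq (is_deriveB (is_derive_cst t s 1) (is_derive_id s 1))).
by rewrite sub0r.
Qed.

Let is_derive_term t s j :
  is_derive s 1 (fun s => exp_coeff (t - s) j.+1) (- exp_coeff (t - s) j).
Proof.
rewrite -mulrN1.
exact: (@is_derive1_comp R (fun y => exp_coeff y j.+1) (fun s => t - s) s _ _
  (is_derive_exp_coeff (t - s) j) (is_derive_opp_shift t s)).
Qed.

Let is_derive_sum_terms t s k :
  is_derive s 1 (fun s => \sum_(j < k) exp_coeff (t - s) j.+1)
    (- \sum_(j < k) exp_coeff (t - s) j).
Proof.
elim: k => [|k IH].
  rewrite big_ord0 oppr0 (_ : (fun s => _) = cst 0); first exact: is_derive_cst.
  by apply/funext => u; rewrite big_ord0.
rewrite (_ : (fun s => _) = (fun s => \sum_(j < k) exp_coeff (t - s) j.+1) +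
    (fun s => exp_coeff (t - s) k.+1)); last first.
  by apply/funext => u; rewrite big_ord_recr.
by rewrite big_ord_recr/= opprD; apply: is_deriveD.
Qed.

Let is_derive_expN (s : R) : is_derive s 1 (fun s : R => expR (- s)) (- expR (- s)).
Proof.
have d := is_deriveN (is_derive_id s (1 : R)).
by rewrite -mulrN1; exact: (is_derive1_comp (is_derive_expR (- s)) d).
Qed.

Let continuous_of_derive (f df : R -> R) :
  (forall s, is_derive s 1 f (df s)) -> continuous f.
Proof.
by move=> h s; apply: differentiable_continuous; apply/derivable1_diffP; case: (h s).
Qed.

(** The convolution step from [k] to [k + 1] gaps: the integrand is
    [expR (- s) * erlang k (t - s)], expanded so that an antiderivative is
    visible. *)
Lemma integral_erlang k t : 0 < t ->
  (\int[lebesgue_measure]_(s in `[0%R, t])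
     (expR (- s) - expR (- t) * \sum_(j < k) exp_coeff (t - s) j)%:E =
   (erlang k.+1 t)%:E)%E.
Proof.
move=> t0.
pose F (s : R) := expR (- t) * (\sum_(j < k) exp_coeff (t - s) j.+1) - expR (- s).
have dF s : is_derive s 1 F (expR (- s) - expR (- t) * \sum_(j < k) exp_coeff (t - s) j).
  have d1 := is_deriveZ (expR (- t)) (is_derive_sum_terms t s k).
  apply: (is_derive_eq (is_deriveB d1 (is_derive_expN s))).
  by rewrite opprK addrC /GRing.scale/= mulrN.
have cF : continuous F by exact: continuous_of_derive dF.
have cterm j : continuous (fun s => exp_coeff (t - s) j).
  case: j => [|j]; last exact: continuous_of_derive (fun s => is_derive_term t s j).
  rewrite (_ : (fun s => _) = cst 1); first by move=> s; exact: cvg_cst.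
  by apply/funext => s; rewrite /exp_coeff /= expr0 fact0 divr1.
rewrite (@continuous_FTC2 _ _ F)//.
- have Ft : F t = - expR (- t).
    rewrite /F subrr big1 ?mulr0 ?sub0r// => j _.
    by rewrite /exp_coeff/= expr0n mul0r.
  have F0 : F 0 = expR (- t) * (\sum_(j < k) exp_coeff t j.+1) - 1.
    by rewrite /F subr0 oppr0 expR0.
  rewrite Ft F0 -EFinB /erlang big_ord_recl; congr EFin.
  have -> : exp_coeff t (ord0 : 'I_k.+1) = 1.
    by rewrite /exp_coeff/= expr0 fact0 divr1.
  under [X in _ = _ - _ * (_ + X)]eq_bigr do rewrite lift0.
  by ring.
- apply: continuous_subspaceT => s; apply: cvgB.
    exact: (continuous_of_derive is_derive_expN).
  apply: cvgMr; apply: cvg_big => [|j _]; first exact: add_continuous.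
  exact: cterm.
- split.
  + by move=> s _; case: (dF s).
  + by apply/cvg_at_right_filter; exact: cF.
  + by apply/cvg_at_left_filter; exact: cF.
- by move=> s _; rewrite derive1E; case: (dF s).
Qed.

End erlang.

(** * The arrival times of a unit rate Poisson process *)

Section erlang_limits.
Variable R : realType.
Implicit Types t : R.

Lemma erlang_at0 k : erlang k.+1 (0 : R) = 0.
Proof.
rewrite /erlang oppr0 expR0 mul1r big_ord_recl big1 => [|j _]; last first.
  by rewrite lift0 /exp_coeff/= expr0n mul0r.
by rewrite /exp_coeff/= expr0 fact0 divr1 addr0 subrr.
Qed.

(** The sum in [erlang] is a partial sum of the exponential series. *)
Lemma cvg_erlang0 t : erlang k t @[k --> \oo] --> 0.
Proof.
rewrite -[X in _ --> X](subrr 1) -[X in _ --> _ - X](expR0 R) -(addNr t) expRD.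
apply: cvgB; first exact: cvg_cst.
apply: cvgMr.
have -> : (fun k => \sum_(j < k) exp_coeff t j) = series (exp_coeff t).
  by apply/funext => k; rewrite /series/= big_mkord.
exact: is_cvg_series_exp_coeff.
Qed.

Lemma erlang_decr k t :
  erlang k t - erlang k.+1 t = expR (- t) * exp_coeff t k.
Proof. by rewrite /erlang big_ord_recr/=; ring. Qed.

End erlang_limits.

Lemma measurable_preim d (T : measurableType d) d2 (T2 : measurableType d2)
    (f : T -> T2) A :
  measurable_fun setT f -> measurable A -> measurable (f @^-1` A).
Proof.
by move=> mf mA; rewrite -[X in measurable X]setTI; exact: mf.
Qed.

(** Both sets have the same union with the null set. *)
Lemma measure_eq_off_null (R : realType) d (T : measurableType d)
    (P : {measure set T -> \bar R}) (N A B : set T) :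
  measurable A -> measurable B -> measurable N -> P N = 0%E ->
  (forall w, ~ N w -> A w <-> B w) -> P A = P B.
Proof.
move=> mA mB mN N0 AB; rewrite -(measureU0 mA mN N0) -(measureU0 mB mN N0).
congr (P _); apply/seteqP; split => w [h|]; do ?by right.
  by have [Nw|/AB[+ _]] := pselect (N w); [right | move=> /(_ h); left].
by have [Nw|/AB[_ +]] := pselect (N w); [right | move=> /(_ h); left].
Qed.

Section arrivals.
Context (R : realType) d (T : measurableType d) (P : probability T R).
Variables (e : T -> R) (V : T -> T).
Hypotheses (me : measurable_fun setT e) (mV : measurable_fun setT V).
Hypothesis e0 : forall w, 0 <= e w.
Hypothesis eE : forall A, measurable A -> P (e @^-1` A) = exponential_prob 1 A.
Hypothesis eV : forall A B, measurable A -> measurable B ->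
  P (e @^-1` A `&` V @^-1` B) = (P (e @^-1` A) * P B)%E.

(** The exponential variable produced at the [i]-th splitting step. *)
Definition gap (i : nat) (w : T) : R := e (iter i V w).
Definition arrival (k : nat) (w : T) : R := \sum_(i < k) gap i w.

Lemma measurable_gap i : measurable_fun setT (gap i).
Proof.
apply: measurableT_comp => //; elim: i => [|i IH]; first exact: measurable_id.
exact: (measurableT_comp mV IH).
Qed.

Lemma measurable_arrival k : measurable_fun setT (arrival k).
Proof. by apply: measurable_sum => i; exact: measurable_gap. Qed.

Lemma arrivalS k w : arrival k.+1 w = e w + arrival k (V w).
Proof.
rewrite /arrival big_ord_recl; congr +%R.
by apply: eq_bigr => i _; rewrite lift0 /gap iterSr.
Qed.

Lemma arrival_ge0 k w : 0 <= arrival k w.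
Proof. by apply: sumr_ge0 => i _; exact: e0. Qed.

Lemma measure_shift B : measurable B -> P (V @^-1` B) = P B.
Proof.
move=> mB; have := eV measurableT mB.
rewrite preimage_setT setTI => ->.
by rewrite (_ : P setT = 1%E) ?mul1e//; exact: probability_setT.
Qed.

Lemma gap_law i A : measurable A -> P (gap i @^-1` A) = exponential_prob 1 A.
Proof.
move=> mA; elim: i => [|i IH]; first exact: eE.
rewrite -IH -(measure_shift (measurable_preim (measurable_gap i) mA)).
by congr (P _); apply/seteqP; split=> w; rewrite /preimage/= /gap iterSr.
Qed.

(** One splitting step detaches the first gap; the remaining gaps are the gaps of
    the independent copy [V w]. *)
Lemma gap_independent_prefix n (A : nat -> set R) :
  (forall i, measurable (A i)) ->
  P [set w | forall i, (i < n)%N -> A i (gap i w)] =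
    (\prod_(i < n) P (gap i @^-1` A i))%E.
Proof.
elim: n A => [|n IH] A mA.
  rewrite big_ord0 (_ : [set _ | _] = setT); first exact: probability_setT.
  by apply/seteqP; split.
rewrite big_ord_recl.
have -> : [set w | forall i, (i < n.+1)%N -> A i (gap i w)] =
    e @^-1` (A 0%N) `&`
    V @^-1` [set w | forall i, (i < n)%N -> A i.+1 (gap i w)].
  apply/seteqP; split => [w h|w [h0 h] [|i] //].
    split; first exact: (h 0%N).
    by move=> i ni; have := h i.+1 ni; rewrite /gap iterSr.
  by rewrite ltnS => /h; rewrite /gap iterSr.
have mS : measurable [set w | forall i, (i < n)%N -> A i.+1 (gap i w)].
  rewrite (_ : [set _ | _] = \bigcap_(i in [set i | (i < n)%N])
     (gap i @^-1` (A i.+1))); last by apply/seteqP; split.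
  by apply: bigcap_measurableType => i _; exact: measurable_preim (measurable_gap i) (mA _).
rewrite eV// (IH (fun i => A i.+1))//; congr (_ * _)%E; apply: eq_bigr => i _.
by rewrite !gap_law.
Qed.

Lemma gap_independent (s : seq nat) (A : nat -> set R) :
  uniq s -> (forall i, measurable (A i)) ->
  P (\bigcap_(i in [set` s]) (gap i @^-1` A i)) =
    (\prod_(i <- s) P (gap i @^-1` A i))%E.
Proof.
move=> us mA.
(* Padding with the sure event reduces a finite family to an initial segment. *)
pose B i := if i \in s then A i else setT.
have mB i : measurable (B i) by rewrite /B; case: ifP.
pose n := (\max_(i <- s) i).+1.
have sn i : i \in s -> (i < n)%N by move=> si; rewrite ltnS; exact: leq_bigmax_seq.
have -> : \bigcap_(i in [set` s]) (gap i @^-1` A i) =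
    [set w | forall i, (i < n)%N -> B i (gap i w)].
  apply/seteqP; split => w h i.
    by move=> _; rewrite /B; case: ifP => // si; exact: h.
  by move=> /= si; have := h i (sn _ si); rewrite /B si.
rewrite (gap_independent_prefix n mB).
rewrite -(big_mkord xpredT (fun i => P (gap i @^-1` B i))).
have ps : perm_eq s [seq i <- index_iota 0 n | i \in s].
  apply: uniq_perm => //; first by rewrite filter_uniq// iota_uniq.
  move=> i; rewrite mem_filter mem_index_iota.
  by case si: (i \in s) => //=; rewrite sn.
rewrite [RHS](perm_big _ ps) [RHS]big_filter [LHS](bigID (fun i => i \in s))/=.
rewrite [X in (_ * X)%E]big1 ?mule1 => [|i /negbTE si]; last first.
  rewrite /B si preimage_setT; exact: probability_setT.
by apply: eq_bigr => i si; rewrite /B si.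
Qed.

(** By [arrivalS] and independence, the law of the next arrival time is the
    convolution of the exponential law with the previous one. *)
Lemma erlang_arrival k t : 0 <= t ->
  P [set w | arrival k w <= t] = (erlang k t)%:E.
Proof.
elim: k t => [|k IH] t t0.
  rewrite (_ : [set _ | _] = setT) ?/erlang ?big_ord0 ?mulr0 ?subr0.
    exact: probability_setT.
  by apply/seteqP; split => // w _; rewrite /= /arrival big_ord0.
have [nu nuE] := exponential_lawP (@ltr01 R).
have nuT : nu setT = 1%E.
  rewrite nuE// -eE// preimage_setT; exact: probability_setT.
have [Q Qnu] := probabilityP nuT.
have QE A : measurable A -> Q A = exponential_prob 1 A.
  by move=> mA; rewrite -nuE Qnu.
have mD : measurable_fun setT (fun z : R * T => z.1 + arrival k z.2).
  apply: measurable_funD => //.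
  exact: (measurableT_comp (measurable_arrival k) measurable_snd).
pose X := [set z : R * T | z.1 + arrival k z.2 <= t].
have mX : measurable X.
  rewrite (_ : X = (fun z : R * T => z.1 + arrival k z.2) @^-1` `]-oo, t]%classic).
    by rewrite -[Y in measurable Y]setTI; exact: mD.
  by apply/seteqP; split => z; rewrite /preimage/= in_itv.
have mp : measurable_fun setT (fun w => (e w, V w)) by exact: measurable_fun_pair.
pose g (x : R) := if x <= t then erlang k (t - x) else 0.
have Pg x : P (xsection X x) = (g x)%:E.
  rewrite /g; case: leP => [xt|tx].
    rewrite -IH ?subr_ge0//; congr (P _); apply/seteqP; split => w;
      by rewrite /xsection/= inE /X/= lerBrDl.
  rewrite (_ : xsection X x = set0) ?measure0//; apply/seteqP; split => // w.
  rewrite /xsection/= inE /X/= => h.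
  by have := arrival_ge0 k w; rewrite leNgt; apply/negP; rewrite negbK; lra.
have mg : measurable_fun setT g.
  apply/measurable_EFinP; rewrite (_ : EFin \o g = P \o xsection X).
    exact: measurable_fun_xsection.
  by apply/funext => x /=; rewrite Pg.
have g01 x : 0 <= g x <= 1.
  by rewrite -!lee_fin -Pg measure_ge0 /=; exact: probability_le1 (measurable_xsection _ mX).
transitivity ((Q \x P)%E X).
  rewrite (@product_measure_unique _ _ _ _ _ Q P (pushforward P (fun w => (e w, V w))))//.
    by congr (P _); apply/seteqP; split => w; rewrite /preimage/= arrivalS.
  move=> A B mA mB; transitivity (P (e @^-1` A) * P B)%E; first exact: eV.
  by congr (_ * _)%E; rewrite eE//; apply/esym; exact: QE.
transitivity (\int[Q]_x (g x)%:E)%E.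
  by apply: eq_integral => x _; exact: Pg.
rewrite (integral_exponential_law (@ltr01 R) QE mg g01).
transitivity (\int[lebesgue_measure]_(s in `[0%R, t])
     (expR (- s) - expR (- t) * \sum_(j < k) exp_coeff (t - s) j)%:E)%E.
  rewrite [RHS]integral_mkcond; apply: eq_integral => x _.
  rewrite patchE mem_setE in_itv/= /g.
  have [x0|x0] := leP 0 x; last by rewrite lt0_exponential_pdf// mul0r.
  rewrite exponential_pdfE//; case: leP => xt; last by rewrite mulr0.
  rewrite mul1r mulN1r /erlang/= mulrBr mulr1 mulrA -expRD.
  by rewrite (_ : - x - (t - x) = - t)//; ring.
move: t0; rewrite le_eqVlt => /predU1P[<-|t0]; last exact: integral_erlang.
by rewrite set_itv1 integral_set1 erlang_at0.
Qed.

Definition explosion : set T :=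
  \bigcup_(m : nat) \bigcap_(k : nat) [set w | arrival k w <= m%:R].

Lemma measurable_arrival_le k t : measurable [set w | arrival k w <= t].
Proof.
rewrite (_ : [set _ | _] = arrival k @^-1` `]-oo, t]%classic).
  exact: measurable_preim (measurable_arrival k) _.
by apply/seteqP; split => z; rewrite /preimage/= in_itv.
Qed.

Lemma measurable_explosion : measurable explosion.
Proof.
apply: bigcupT_measurable => m; apply: bigcapT_measurable => k.
exact: measurable_arrival_le.
Qed.

(** The event that all arrivals occur before [m] has probability at most
    [erlang k m] for every [k]. *)
Lemma explosion_null : P explosion = 0%E.
Proof.
apply: (measure_negligible measurable_explosion).
apply: negligible_bigcup => m.
have mB : measurable (\bigcap_(k : nat) [set w | arrival k w <= m%:R]).
  by apply: bigcapT_measurable => k; exact: measurable_arrival_le.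
apply/(negligibleP P mB)/eqP; rewrite -measure_le0.
have fB : P (\bigcap_(k : nat) [set w | arrival k w <= m%:R]) \is a fin_num.
  exact: fin_num_measure.
apply: (@le_trans _ _ (fine (P (\bigcap_(k : nat) [set w | arrival k w <= m%:R])))%:E).
  by rewrite fineK.
rewrite lee_fin -[leRHS](cvg_lim (@Rhausdorff R) (@cvg_erlang0 R m%:R)).
apply: limr_ge; first by apply/cvg_ex; exists 0; exact: cvg_erlang0.
near=> k; rewrite -lee_fin fineK// -erlang_arrival//.
apply: le_measure; rewrite ?inE//; first exact: measurable_arrival_le.
by move=> w /(_ k I).
Unshelve. all: by end_near.
Qed.

(** The gaps, modified on a null set so that the arrival times are unbounded at
    every outcome: a counting process with values in the naturals must be
    defined everywhere. *)
Definition interarrival (i : nat) : T -> R :=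
  fun w => if w \in explosion then 1 else gap i w.

Lemma measurable_interarrival i : measurable_fun setT (interarrival i).
Proof.
apply: measurable_fun_ifT => //; last exact: measurable_gap.
apply: (measurable_fun_bool true).
rewrite setTI (_ : _ @^-1` _ = explosion); first exact: measurable_explosion.
apply/seteqP; split => w /=; first by move/set_mem.
by move=> h; exact: mem_set.
Qed.

Lemma interarrivalE i w : ~ explosion w -> interarrival i w = gap i w.
Proof. by rewrite /interarrival => h; rewrite memNset. Qed.

Lemma interarrival_ge0 i w : 0 <= interarrival i w.
Proof. by rewrite /interarrival; case: ifP => // _; exact: e0. Qed.

Lemma interarrival_unbounded w (t : R) :
  exists k, t < \sum_(i < k) interarrival i w.
Proof.
have [h|h] := pselect (explosion w).
  exists (Num.truncn t).+1.
  rewrite (eq_bigr (fun _ => 1)) => [|i _]; last by rewrite /interarrival mem_set.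
  by rewrite sumr_const card_ord; exact: Num.Theory.truncnS_gt.
apply: contrapT => nk; apply: (h); exists (Num.truncn t).+1 => // k _ /=.
apply: (@le_trans _ _ t); last by apply/ltW; exact: Num.Theory.truncnS_gt.
rewrite leNgt; apply/negP => tk; apply: nk; exists k.
by under eq_bigr do rewrite interarrivalE//.
Qed.

Lemma interarrival_preimage i A : measurable A ->
  P (interarrival i @^-1` A) = P (gap i @^-1` A).
Proof.
move=> mA; apply: (@measure_eq_off_null _ _ _ P explosion).
- exact: measurable_preim (measurable_interarrival i) mA.
- exact: measurable_preim (measurable_gap i) mA.
- exact: measurable_explosion.
- exact: explosion_null.
- by move=> w h; rewrite /preimage/= interarrivalE.
Qed.

Lemma interarrival_independent (s : seq nat) (A : nat -> set R) :
  uniq s -> (forall i, measurable (A i)) ->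
  P (\bigcap_(i in [set` s]) (interarrival i @^-1` A i)) =
    (\prod_(i <- s) P (interarrival i @^-1` A i))%E.
Proof.
move=> us mA; under eq_bigr do rewrite interarrival_preimage//.
rewrite -gap_independent//; apply: (@measure_eq_off_null _ _ _ P explosion).
- apply: bigcap_measurableType => i _.
  exact: measurable_preim (measurable_interarrival i) (mA i).
- apply: bigcap_measurableType => i _.
  exact: measurable_preim (measurable_gap i) (mA i).
- exact: measurable_explosion.
- exact: explosion_null.
- by move=> w h; split => + i si => /(_ i si); rewrite /preimage/= interarrivalE.
Qed.

Lemma interarrival_sum_law k t : 0 <= t ->
  P [set w | \sum_(i < k) interarrival i w <= t] = (erlang k t)%:E.
Proof.
move=> t0; rewrite -erlang_arrival//; apply: (@measure_eq_off_null _ _ _ P explosion).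
- have mS : measurable_fun setT (fun w => \sum_(i < k) interarrival i w).
    by apply: measurable_sum => i; exact: measurable_interarrival.
  rewrite (_ : [set _ | _] =
      (fun w => \sum_(i < k) interarrival i w) @^-1` `]-oo, t]%classic).
    exact: measurable_preim mS _.
  by apply/seteqP; split => z; rewrite /preimage/= in_itv.
- exact: measurable_arrival_le.
- exact: measurable_explosion.
- exact: explosion_null.
- by move=> w h /=; under eq_bigr do rewrite interarrivalE//.
Qed.

End arrivals.

Lemma random_variableP (R : realType) d (T : measurableType d)
    (P : probability T R) (f : T -> R) :
  measurable_fun setT f -> exists X : {RV P >-> R}, X = f :> (T -> R).
Proof.
move=> mf.
by exists (HB.pack_for {RV P >-> R} f (isMeasurableFun.Build _ _ _ _ f mf)).
Qed.

Lemma exponential_interarrivals (R : realType) :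
  exists (d : measure_display) (T : measurableType d) (P : probability T R)
    (E : nat -> {RV P >-> R}),
  [/\ independent_RVs E,
      forall k (A : set R), measurable A ->
        distribution P (E k) A = exponential_prob 1 A,
      forall k w, 0 <= E k w,
      forall w (t : R), exists k, t < \sum_(i < k) E i w &
      forall k (t : R), 0 <= t ->
        P [set w | \sum_(i < k) E i w <= t] = (erlang k t)%:E].
Proof.
have [d [T [P [e [V [me mV e0 eE eV]]]]]] := exponential_source R.
have /choice[E EE] i := random_variableP P (measurable_interarrival me mV i).
exists d, T, P, E; split.
- move=> s A us mA; under eq_bigr do rewrite EE.
  rewrite -(interarrival_independent me mV e0 eE eV us mA); congr (P _).
  by apply/seteqP; split => w h i /h; rewrite /preimage/= EE.
- move=> k A mA; rewrite -(gap_law me mV eE eV k mA).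
  rewrite -(interarrival_preimage me mV e0 eE eV k mA) -(EE k).
  by [].
- by move=> k w; rewrite EE; exact: interarrival_ge0.
- move=> w t; have [k tk] := interarrival_unbounded e V w t.
  by exists k; under eq_bigr do rewrite EE.
- move=> k t t0; rewrite -(interarrival_sum_law me mV e0 eE eV k t0).
  have Es w : \sum_(i < k) E i w = \sum_(i < k) interarrival e V i w.
    by apply: eq_bigr => i _; rewrite EE.
  by congr (P _); apply/seteqP; split => w /=; rewrite Es.
Qed.

(** The value at time [t] is one less than the first number of gaps whose sum
    exceeds [t]. *)
Lemma counting_process (R : realType) (T : Type) (E : nat -> T -> R) :
  (forall k w, 0 <= E k w) ->
  (forall w (t : R), exists k, t < \sum_(i < k) E i w) ->
  exists N : R -> T -> nat, forall (t : R) (w : T) (k : nat), 0 <= t ->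
    (k <= N t w)%N = (\sum_(i < k) E i w <= t).
Proof.
move=> E0 Eoo.
suff /choice[N NE] : forall tw : R * T, exists n, forall k, 0 <= tw.1 ->
    (k <= n)%N = (\sum_(i < k) E i tw.2 <= tw.1).
  by exists (fun t w => N (t, w)) => t w k t0; exact: (NE (t, w)).
move=> [t w]; have [n nt nmin] := ex_minnP (Eoo w t).
(* [n] is positive because the empty sum is at most [t]. *)
exists n.-1 => k /= t0.
have n0 : (0 < n)%N.
  by case: n nt {nmin} => //; rewrite big_ord0 ltNge t0.
have mono j l : (j <= l)%N -> \sum_(i < j) E i w <= \sum_(i < l) E i w.
  elim: l => [|l IH]; first by rewrite leqn0 => /eqP->.
  rewrite leq_eqVlt => /predU1P[->//|/IH h]; apply: le_trans h _.
  by rewrite big_ord_recr/= lerDl.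
apply/idP/idP => [kn|kt]; last first.
  rewrite -ltnS prednK// ltnNge; apply/negP => /mono h.
  by have := lt_le_trans nt (le_trans h kt); rewrite ltxx.
rewrite leNgt; apply/negP => /nmin; rewrite leqNgt; apply/negP; rewrite negbK.
by rewrite -(prednK n0) ltnS.
Qed.

(** * A Poisson process stopped at an independent random time *)

Section integer_valued.
Context (R : realType) d (T : measurableType d) (P : probability T R).

(** Two laws carried by the naturals are compared through their atoms. *)
Lemma measure_integer_valued (f : T -> R) (A : set R) :
  (forall k : nat, measurable (f @^-1` [set k%:R])) ->
  measurable (f @^-1` A) ->
  P (~` \bigcup_(k : nat) (f @^-1` [set k%:R])) = 0%E ->
  P (f @^-1` A) = (\sum_(0 <= k <oo)
    if (k%:R : R) \in A then P (f @^-1` [set k%:R]) else 0)%E.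
Proof.
move=> mf mA null.
pose F (k : nat) := if (k%:R : R) \in A then f @^-1` [set k%:R] else set0.
have mF k : measurable (F k) by rewrite /F; case: ifP.
transitivity (P (\bigcup_k F k)).
  apply: (@measure_eq_off_null _ _ _ _ (~` \bigcup_(k : nat) (f @^-1` [set k%:R]))) => //.
  - exact: bigcupT_measurable.
  - by apply: measurableC; exact: bigcupT_measurable.
  - move=> w /contrapT[k _ fk]; split => [Aw|[j _]]; rewrite /F.
      by exists k => //; rewrite (_ : k%:R \in A = true)//; apply/mem_set; rewrite -fk.
    by case: ifPn => // /set_mem Aj fj; rewrite /preimage/= fj.
rewrite measure_semi_bigcup//; last 2 first.
- move=> i j _ _ [w []]; rewrite /F; case: ifPn => // _ fi; case: ifPn => // _ fj.
  by apply/eqP; rewrite -(eqr_nat R) -fi -fj.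
- exact: bigcupT_measurable.
by apply: eq_eseriesr => k _; rewrite /F; case: ifP => //; rewrite measure0.
Qed.

End integer_valued.

Section poisson_mixture.
Variable R : realType.

Definition poisson_weight (k : nat) (t : R) : R := expR (- t) * exp_coeff t k.

Lemma poisson_weight_ge0 k t : 0 <= t -> 0 <= poisson_weight k t.
Proof. by move=> t0; rewrite mulr_ge0 ?expR_ge0// exp_coeff_ge0. Qed.

Lemma measurable_poisson_weight k : measurable_fun setT (poisson_weight k).
Proof.
apply: measurable_funM.
  by apply: measurableT_comp => //; exact: measurable_funN.
by apply: measurable_funM => //; exact: exprn_measurable.
Qed.

Lemma poisson_weight_pgf (x t : R) : 0 <= x -> 0 <= t ->
  (\sum_(0 <= k <oo) (x ^+ k * poisson_weight k t)%:E = (expR (- (t * (1 - x))))%:E)%E.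
Proof.
move=> x0 t0; apply/cvg_lim => //.
have -> : (fun n => \sum_(0 <= k < n) (x ^+ k * poisson_weight k t)%:E)%E =
    (fun n => (expR (- t) * series (exp_coeff (t * x)) n)%:E).
  apply/funext => n; rewrite sumEFin /series/= mulr_sumr; congr EFin.
  by apply: eq_bigr => k _; rewrite /poisson_weight /exp_coeff/= exprMn; ring.
rewrite (_ : - (t * (1 - x)) = - t + t * x); last by ring.
rewrite expRD; apply: cvg_EFin; first exact: nearW.
apply: cvgMr; exact: is_cvg_series_exp_coeff.
Qed.

Context d (T : measurableType d) (P : probability T R) (E : nat -> {RV P >-> R}).
Hypothesis E_indep : independent_RVs E.
Hypothesis E_law : forall k (A : set R), measurable A ->
  distribution P (E k) A = exponential_prob 1 A.
Hypothesis E_sum : forall k (t : R), 0 <= t ->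
  P [set w | \sum_(i < k) E i w <= t] = (erlang k t)%:E.
Variable N : R -> T -> nat.
Hypothesis NE : forall (t : R) (w : T) (k : nat), 0 <= t ->
  (k <= N t w)%N = (\sum_(i < k) E i w <= t).

Let measurable_sum_le k (t : R) : measurable [set w | \sum_(i < k) E i w <= t].
Proof.
have mS : measurable_fun setT (fun w => \sum_(i < k) E i w).
  by apply: measurable_sum => i.
rewrite (_ : [set _ | _] =
    (fun w => \sum_(i < k) E i w) @^-1` `]-oo, t]%classic).
  by rewrite -[Y in measurable Y]setTI; exact: mS.
by apply/seteqP; split => z; rewrite /preimage/= in_itv.
Qed.

Let count_eq (t : R) (k : nat) : 0 <= t ->
  [set w | N t w = k] = [set w | \sum_(i < k) E i w <= t] `\`
    [set w | \sum_(i < k.+1) E i w <= t].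
Proof.
move=> t0; apply/seteqP; split => w /=; rewrite -!NE//.
  by move=> <-; rewrite leqnn ltnn.
by move=> [kN /negP]; rewrite -ltnNge ltnS => Nk; apply/eqP; rewrite eqn_leq Nk.
Qed.

(** The event of exactly [k] arrivals by time [t] is the difference of the events
    of at least [k] and at least [k + 1] arrivals. *)
Lemma count_marginal (t : R) (k : nat) : 0 <= t ->
  P [set w | N t w = k] = (poisson_weight k t)%:E.
Proof.
move=> t0; rewrite count_eq// measureD//; last first.
  by apply: (le_lt_trans (probability_le1 P (measurable_sum_le k t))); exact: ltry.
rewrite setIidr => [|w /=]; last by rewrite -!NE//; exact: ltnW.
transitivity ((erlang k t)%:E - (erlang k.+1 t)%:E)%E.
  by congr (_ - _)%E; exact: E_sum.
by rewrite -EFinB erlang_decr.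
Qed.

Lemma measurable_count (t : R) (B : set nat) : 0 <= t -> measurable (N t @^-1` B).
Proof.
move=> t0; rewrite (_ : _ @^-1` _ = \bigcup_(k in B) [set w | N t w = k]).
  by apply: bigcup_measurable => k _; rewrite count_eq//; exact: measurableD.
apply/seteqP; split => [w Bw|w [k Bk /= Nk]]; first by exists (N t w).
by rewrite /preimage/= Nk.
Qed.

Context (Q : probability R R) (lam : R -> R).
Hypotheses (mlam : measurable_fun setT lam) (lam0 : forall u, 0 <= lam u).

Let PP : probability (R * T)%type R := (Q \x P)%E.

Let PP_prod A B : measurable A -> measurable B -> PP (A `*` B) = (Q A * P B)%E.
Proof. by move=> mA mB; exact: product_measure1E. Qed.

Let PP_snd B : measurable B -> PP (snd @^-1` B) = P B.
Proof.
move=> mB; rewrite -setTX PP_prod//.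
have -> : Q setT = 1%E by exact: probability_setT.
by rewrite mul1e.
Qed.

Let PP_fst A : measurable A -> PP (fst @^-1` A) = Q A.
Proof.
move=> mA; rewrite -setXT PP_prod//.
have -> : P setT = 1%E by exact: probability_setT.
by rewrite mule1.
Qed.

(** Fubini on the product of the space of the mixing variable with that of the
    process. *)
Lemma mixed_count k : PP [set z | N (lam z.1) z.2 = k] =
  (\int[Q]_u (poisson_weight k (lam u))%:E)%E.
Proof.
apply: eq_integral => u _.
rewrite /= -count_marginal//; congr (P _).
by apply/seteqP; split => w; rewrite /xsection/= inE.
Qed.

Lemma measurable_mixed_count k : measurable [set z : R * T | N (lam z.1) z.2 = k].
Proof.
have mS j : measurable [set z : R * T | \sum_(i < j) E i z.2 <= lam z.1].
  have m1 : measurable_fun setT (fun z : R * T => \sum_(i < j) E i z.2).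
    by apply: measurable_sum => i; apply: (measurableT_comp _ measurable_snd).
  have m2 : measurable_fun setT (fun z : R * T => lam z.1).
    exact: (measurableT_comp mlam measurable_fst).
  by rewrite -[X in measurable X]setTI; exact: measurable_fun_le.
rewrite (_ : [set _ | _] = [set z : R * T | \sum_(i < k) E i z.2 <= lam z.1] `\`
    [set z : R * T | \sum_(i < k.+1) E i z.2 <= lam z.1]).
  exact: measurableD.
apply/seteqP; split => z; have := count_eq k (lam0 z.1).
  by move=> /seteqP[+ _] => /(_ z.2).
by move=> /seteqP[_ +] => /(_ z.2).
Qed.

(** The witness is the product space: the time is read on the first factor and
    the process on the second, so that an event generated by the process is the
    preimage of an event of the second factor, whence independence. *)
Lemma mixed_Poisson_mixture (mu : set R -> \bar R) :
  (forall A, measurable A -> mu A = (\sum_(0 <= k <oo)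
    if (k%:R : R) \in A then \int[Q]_u (poisson_weight k (lam u))%:E else 0)%E) ->
  mixed_Poisson mu.
Proof.
move=> muE.
have [Lam LamE] := random_variableP PP (measurableT_comp mlam measurable_fst).
have /choice[E' E'E] i := random_variableP PP
  (measurableT_comp (measurable_funPT (E i)) measurable_snd).
exists _, _, PP, (fun t z => N t z.2), Lam; split.
- exists E'; split.
  + move=> s A us mA.
    have mE i : measurable (E i @^-1` A i).
      by rewrite -[X in measurable X]setTI; exact: measurable_funPT.
    under [RHS]eq_bigr do rewrite E'E -[_ @^-1` _]/(snd @^-1` (E _ @^-1` A _)) PP_snd//.
    rewrite -E_indep// -PP_snd; last by apply: bigcap_measurableType.
    congr (PP _); apply/seteqP; split => z h i /h; by rewrite /preimage/= E'E.
  + move=> k A mA; rewrite -(E_law k mA) /distribution/= /pushforward E'E.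
    apply: PP_snd; rewrite -[X in measurable X]setTI; exact: measurable_funPT.
  + by move=> t z k t0; rewrite NE//; congr (_ <= _); apply: eq_bigr => i _; rewrite E'E.
- by move=> z; rewrite LamE; exact: lam0.
- move=> A B mA /(smallest_sub (sigma_algebra_preimage setT (@snd R T)
    (sigma_algebra_measurable T)))-/(_ _)[].
    move=> _ [t /= t0] [C _ <-]; exists (N t @^-1` C); first exact: measurable_count.
    by rewrite !setTI.
  move=> C mC <-; rewrite setTI.
  have mA' : measurable (lam @^-1` A) by rewrite -[X in measurable X]setTI; exact: mlam.
  rewrite PP_snd// LamE.
  rewrite (_ : _ `&` _ = (lam @^-1` A) `*` C)// PP_prod//.
  by rewrite -PP_fst.
- move=> A mA; rewrite muE//.
  pose f (z : R * T) : R := (N (lam z.1) z.2)%:R.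
  have fk k : f @^-1` [set k%:R] = [set z | N (lam z.1) z.2 = k].
    apply/seteqP; split => z; rewrite /preimage/f/=; last by move=> ->.
    by move/eqP; rewrite eqr_nat => /eqP.
  have mf B : measurable (f @^-1` B).
    rewrite (_ : f @^-1` B = \bigcup_(k in [set k : nat | B k%:R])
      [set z | N (lam z.1) z.2 = k]).
      by apply: bigcup_measurable => k _; exact: measurable_mixed_count.
    apply/seteqP; split => [z Bz|z [k /= Bk Nk]]; first by exists (N (lam z.1) z.2).
    by rewrite /preimage/f/= Nk.
  transitivity (PP (f @^-1` A)); last first.
    by congr (PP _); apply/seteqP; split => z; rewrite /preimage/= LamE.
  rewrite measure_integer_valued//; last first.
    rewrite (_ : ~` _ = set0) ?measure0//; apply/seteqP; split => // z; apply.
    by exists (N (lam z.1) z.2).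
  by apply: eq_eseriesr => k _; case: ifP => // _; rewrite fk mixed_count.
Qed.

End poisson_mixture.

(** * Poisson mixtures from generating functions *)

(** The mixing variable is [- ln (Y u)].  On the event [Y u > 0] one has
    [Y u `^ s = expR (- s * lam u)], and [Y u `^ s] vanishes off it, so the
    generating function of [p] is that of the subprobability with weights the
    integrals of [g k].  Coefficients therefore agree, and since [p] has total
    mass one the event [Y u > 0] has full measure. *)
Lemma mixed_Poisson_pgf (R : realType) (nu mu : {measure set R -> \bar R})
    (Y : R -> R) (p : nat -> R) :
  nu setT = 1%E -> measurable_fun setT Y -> (forall u, 0 <= Y u <= 1) ->
  (forall k, 0 <= p k) -> (\sum_(0 <= k <oo) (p k)%:E = 1)%E ->
  (forall A, measurable A -> mu A = (\sum_(0 <= k <oo)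
    if (k%:R : R) \in A then (p k)%:E else 0)%E) ->
  (forall s : R, 0 < s < 1 -> (\int[nu]_u (Y u `^ s)%:E =
    \sum_(0 <= k <oo) ((1 - s) ^+ k * p k)%:E)%E) ->
  mixed_Poisson mu.
Proof.
move=> nu1 mY Y01 p0 p1 muE Yp.
have [Q QE] := probabilityP nu1.
pose lam u := - ln (Y u).
have lam0 u : 0 <= lam u.
  by rewrite oppr_ge0; have /andP[_ h] := Y01 u; exact: ln_le0.
have mlam : measurable_fun setT lam.
  by apply: measurable_funN; exact: (measurableT_comp (@measurable_ln R) mY).
pose pos : set R := Y @^-1` `]0, +oo[%classic.
have mpos : measurable pos by rewrite -[X in measurable X]setTI; exact: mY.
pose g k u : R := \1_pos u * poisson_weight k (lam u).
have mg k : measurable_fun setT (g k).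
  apply: measurable_funM; first exact: measurable_indic.
  exact: (measurableT_comp (measurable_poisson_weight k) mlam).
have g0 k u : 0 <= g k u by rewrite mulr_ge0 ?poisson_weight_ge0// indicE; case: (_ \in _).
have g_pgf (x : R) : 0 <= x -> (\sum_(0 <= k <oo) \int[Q]_u (x ^+ k * g k u)%:E =
    \int[Q]_u (\1_pos u * expR (- (lam u * (1 - x))))%:E)%E.
  move=> x0; rewrite -integral_nneseries//; last 2 first.
  - by move=> k; apply/measurable_EFinP; apply: measurable_funM.
  - by move=> k u _; rewrite lee_fin mulr_ge0// exprn_ge0.
  apply: eq_integral => u _; rewrite EFinM -poisson_weight_pgf// -nneseriesZl//; last first.
    by move=> k _; rewrite lee_fin mulr_ge0 ?exprn_ge0 ?poisson_weight_ge0.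
  by apply: eq_eseriesr => k _; rewrite -EFinM /g; congr EFin; ring.
have Qpos : (\int[Q]_u (\1_pos u)%:E = Q pos)%E by rewrite integral_indic// setIT.
have g_sum : (\sum_(0 <= k <oo) \int[Q]_u (g k u)%:E = Q pos)%E.
  transitivity (\int[Q]_u (\1_pos u * expR (- (lam u * (1 - 1))))%:E)%E.
    rewrite -g_pgf//; apply: eq_eseriesr => k _; apply: eq_integral => u _.
    by rewrite expr1n mul1r.
  by rewrite -Qpos; apply: eq_integral => u _; rewrite subrr mulr0 oppr0 expR0 mulr1.
have ig0 k : (0 <= \int[Q]_u (g k u)%:E)%E by apply: integral_ge0 => u _; rewrite lee_fin.
have Qpos1 : (Q pos <= 1)%E by exact: probability_le1.
have ig1 k : (\int[Q]_u (g k u)%:E <= 1)%E.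
  apply: le_trans Qpos1; rewrite -g_sum.
  by rewrite (@nneseriesD1 _ _ k)//; rewrite leeDl//; exact: nneseries_ge0.
have igf k : (\int[Q]_u (g k u)%:E \is a fin_num)%E.
  by rewrite ge0_fin_numE//; apply: (le_lt_trans (ig1 k)); exact: ltry.
have pE : forall k, fine (\int[Q]_u (g k u)%:E)%E = p k.
  apply: power_series_unique => //.
  - by move=> k; exact: fine_ge0.
  - by under eq_eseriesr do rewrite fineK//; rewrite g_sum.
  - by rewrite p1.
  - move=> x /andP[x0 x1].
    have s01 : 0 < 1 - x < 1 by rewrite subr_gt0 x1 gtrBl.
    have := Yp _ s01; rewrite (_ : 1 - (1 - x) = x); last by ring.
    move=> <-; rewrite QE.
    transitivity (\int[Q]_u (\1_pos u * expR (- (lam u * (1 - x))))%:E)%E.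
      rewrite -g_pgf ?ltW//; apply: eq_eseriesr => k _.
      rewrite EFinM fineK// -ge0_integralZl_EFin ?exprn_ge0 ?ltW//.
        by move=> u _; rewrite lee_fin.
      exact/measurable_EFinP.
    apply: eq_integral => u _; congr EFin; rewrite indicE; have /andP[Y0 _] := Y01 u.
    move: Y0; rewrite le_eqVlt => /predU1P[Yu|Yu].
      rewrite -Yu powR0 ?subr_eq0 ?gt_eqF// memNset ?mul0r//.
      by rewrite /pos /preimage/= -Yu in_itv/= ltxx.
    rewrite mem_set; last by rewrite /pos/preimage/= in_itv/= Yu.
    by rewrite mul1r /powR gt_eqF// /lam mulNr opprK mulrC.
have Qpos_full : Q pos = 1%E.
  by rewrite -g_sum -p1; apply: eq_eseriesr => k _; rewrite -pE fineK.
have pI k : (\int[Q]_u (poisson_weight k (lam u))%:E = (p k)%:E)%E.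
  rewrite -pE fineK//; apply: ge0_ae_eq_integral => //.
  - apply/measurable_EFinP; exact: (measurableT_comp (measurable_poisson_weight k) mlam).
  - exact/measurable_EFinP.
  - by move=> u _; rewrite lee_fin poisson_weight_ge0.
  - by move=> u _; rewrite lee_fin.
  - exists (~` pos); split; first exact: measurableC.
      by apply: etrans (probability_setC Q mpos) _; rewrite Qpos_full subee.
    move=> u /= nh pu; apply: nh => _; rewrite /g indicE mem_set// mul1r//.
have [d [T [P [E [Eind Elaw E0 Eoo Esum]]]]] := exponential_interarrivals R.
have [N NE] := counting_process E0 Eoo.
apply: (mixed_Poisson_mixture Eind Elaw Esum NE mlam lam0 (Q := Q)).
by move=> A mA; rewrite muE//; apply: eq_eseriesr => k _; rewrite pI.
Qed.

Theorem proposition1p2 (R : realType)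
    (d0 : measure_display) (T0 : measurableType d0) (P0 : probability T0 R)
    (W0 : {RV P0 >-> R})
    (hW0 : forall w, 0 < W0 w < 1)
    (d : measure_display) (T : measurableType d) (P : probability T R)
    (W : nat -> {RV P >-> R})
    (hW : independent_copies W0 W)
    (X : forall n : nat, 'I_n -> {RV P >-> nat})
    (hX : forall n : nat, sieve_allocation W (X n))
    (d' : measure_display) (T' : measurableType d') (P' : probability T' R)
    (L : {RV P' >-> R})
    (hL : nondegenerate_law L)
    (hcvg : cvg_in_distribution P (fun n w => (empty_boxes (X n) w)%:R) L) :
  mixed_Poisson (distribution P' L).
Proof.
have mL A : measurable A -> measurable (L @^-1` A).
  by move=> mA; rewrite -[Y in measurable Y]setTI; exact: measurable_funPT.
pose p k := fine (P' (L @^-1` [set k%:R])).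
have p0 k : 0 <= p k by exact: fine_ge0.
have pE k : P' (L @^-1` [set k%:R]) = (p k)%:E.
  by rewrite fineK//; exact: fin_num_measure.
have LE A : measurable A -> distribution P' L A = (\sum_(0 <= k <oo)
    if (k%:R : R) \in A then (p k)%:E else 0)%E.
  move=> mA; transitivity (\sum_(0 <= k <oo) if (k%:R : R) \in A
      then P' (L @^-1` [set k%:R]) else 0)%E; last first.
    by apply: eq_eseriesr => k _; rewrite pE.
  apply: (@measure_integer_valued _ _ _ P' L) => [k||]; do ?exact: mL.
  apply: measure_negligible.
    by apply: measurableC; apply: bigcupT_measurable => k; exact: mL.
  apply: negligibleS (limit_integer_valued hcvg) => w /= h [k Lw].
  by apply: h; exists k.
have p1 : (\sum_(0 <= k <oo) (p k)%:E = 1)%E.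
  transitivity (distribution P' L setT); last exact: probability_setT.
  by rewrite LE//; apply: eq_eseriesr => k _; rewrite mem_set.
have /choice[phi phiP] n := laplace_mixture_empty_boxes hW0 hW (hX n).
(* [psi s] is E (1 - s) ^ L, the limit of the transforms at [s]. *)
pose psi (s : R) := fine (\sum_(0 <= k <oo) ((1 - s) ^+ k * p k)%:E)%E.
have psiE s : 0 < s < 1 ->
    ((psi s)%:E = \sum_(0 <= k <oo) ((1 - s) ^+ k * p k)%:E)%E.
  move=> /andP[s0 s1]; have x0 : 0 <= 1 - s by rewrite subr_ge0 ltW.
  have t0 k : (0 <= ((1 - s) ^+ k * p k)%:E)%E by rewrite lee_fin mulr_ge0 ?exprn_ge0.
  rewrite fineK// ge0_fin_numE; last exact: nneseries_ge0.
  apply: (@le_lt_trans _ _ 1%E); last exact: ltry.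
  rewrite -p1; apply: lee_nneseries => // k _.
  by rewrite lee_fin ler_piMl// exprn_ile1// gerBl ltW.
have cphi s : 0 < s < 1 -> phi n s @[n --> \oo] --> psi s.
  move=> s01; have /andP[s0 s1] := s01.
  have x01 : 0 < 1 - s < 1 by rewrite subr_gt0 s1 gtrBl.
  have := pgf_limit hcvg x01; rewrite -psiE// => h.
  suff h2 : (phi n s)%:E @[n --> \oo] --> (psi s)%:E by exact: fine_cvg h2.
  apply: cvg_trans h; apply: near_eq_cvg; apply: nearW => n /=.
  by have [_ _ ->] := phiP n; rewrite ?ltW.
have [nu nuE] := uniform_lawP R.
have [|||||Y [mY Y01 Ypsi]] := @laplace_mixture_compact R phi psi nu.
- by move=> n; case: (phiP n).
- by move=> n; case: (phiP n).
- exact: cphi.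
- exact: uniform_law_setT nuE.
- by move=> a; exact: uniform_law_ray nuE.
apply: (mixed_Poisson_pgf (uniform_law_setT nuE) mY Y01 p0 p1 LE).
by move=> s s01; rewrite Ypsi// psiE.
Qed.
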